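(* Let $d\ge 1$, let $(\Omega,\mathcal F,(\mathcal F_t)_{0\le t\le T},P)$ be a stochastic basis with $\mathcal F=\mathcal F_T$, let the asset prices $S^j_t=S^j_0\exp(H^j_t)$, $0\le t\le T$, $1\le j\le d$, with $S^j_0>0$ be modeled as exponential semimartingales (see context), let $X_T=\Psi(H_t,\,0\le t\le T)$ be an $\mathcal F_T$-measurable $\mathbb R^d$-valued random variable, where $\Psi$ is an $\mathbb R^d$-valued measurable functional, and let $f:\mathbb R^d\to\mathbb R_+$ be measurable. Let $R\in\mathbb R^d$, let $g(x)=\mathrm e^{-\langle R,x\rangle}f(x)$, $x\in\mathbb R^d$, and let $\varrho(\mathrm dx)=\mathrm e^{\langle R,x\rangle}P_{X_T}(\mathrm dx)$, where $P_{X_T}$ is the law of $X_T$. Assume that 1. $g\in L^1(\mathbb R^d)$; 2. $M_{X_T}(R)=E[\mathrm e^{\langle R,X_T\rangle}]$ exists (is finite); 3. $\widehat\varrho\in L^1(\mathbb R^d)$. Then the time-$0$ price function $\mathbb V_f(X;\mathsf s)=E[f(X_T-\mathsf s)]$, $\mathsf s\in\mathbb R^d$, is given by $$\mathbb V_f(X;\mathsf s)=\frac{\mathrm e^{-\langle R,\mathsf s\rangle}}{(2\pi)^d}\int_{\mathbb R^d}\mathrm e^{-i\langle u,\mathsf s\rangle}\,M_{X_T}(R+iu)\,\widehat f(iR-u)\,\mathrm du .$$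
   Context: Model. $H=(H^1,\dots,H^d)^\top$ is an $\mathbb R^d$-valued semimartingale on the stochastic basis, each component having canonical representation $H^j=H^j_0+B^j+H^{j,c}+h^j(x)*(\mu-\nu)+(x^j-h^j(x))*\mu$, where $h$ is an $\mathbb R^d$-valued truncation function with components $h^j$, $B^j$ is predictable of bounded variation, $H^{j,c}$ is the continuous martingale part, $\mu$ is the random measure of jumps of $H$ and $\nu$ its predictable compensator; $*$ denotes the (stochastic) integral process with respect to a random measure. $P$ is a martingale measure for the assets (each $S^j$ is a local martingale under $P$), and interest rate and dividend yield are zero. Option. The payoff at maturity $T$ is $f(X_T-\mathsf s)$ with $\mathsf s=(\mathsf s^1,\dots,\mathsf s^d)$, $\mathsf s^j=-\log S^j_0$, and its time-$0$ price, regarded as a function of $\mathsf s\in\mathbb R^d$ (the law of $X_T$ being fixed), is $\mathbb V_f(X;\mathsf s)=E[f(X_T-\mathsf s)]$, the expectation being under $P$. Notation. $\langle u,v\rangle=\sum_k u_kv_k$ for $u,v\in\mathbb C^d$ (bilinear, not Hermitian). $M_{X_T}(z)=E[\mathrm e^{\langle z,X_T\rangle}]$ for those $z\in\mathbb C^d$ for which it is defined. Fourier transforms: $\widehat f(z)=\int_{\mathbb R^d}\mathrm e^{i\langle z,x\rangle}f(x)\,\mathrm dx$ for those $z\in\mathbb C^d$ for which the integral converges absolutely, and $\widehat\varrho(u)=\int_{\mathbb R^d}\mathrm e^{i\langle u,x\rangle}\varrho(\mathrm dx)=M_{X_T}(R+iu)$ for $u\in\mathbb R^d$. *)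

(* Defs.v *)
From HB Require Import structures.
From mathcomp Require Import all_boot all_order all_algebra.
From mathcomp Require Import all_classical all_reals all_analysis.
From mathcomp Require Import measurable_realfun.
From mathcomp Require Import complex.

Set Implicit Arguments.
Unset Strict Implicit.
Unset Printing Implicit Defensive.

Import Order.TTheory GRing.Theory Num.Theory.
Import numFieldTopology.Exports numFieldNormedType.Exports.

Local Open Scope classical_set_scope.
Local Open Scope ring_scope.
Local Open Scope complex_scope.

(** Vectors of [R^d] are tuples [d.-tuple R]; the sigma-algebra the library puts
    on that type is the product one, i.e. the Borel sigma-algebra of [R^d]. *)

(* bilinear, not Hermitian, also for K = R[i] *)
Definition dotp (K : pzRingType) (d : nat) (u v : d.-tuple K) : K :=
  \sum_(k < d) tnth u k * tnth v k.

Definition subt (K : zmodType) (d : nat) (u v : d.-tuple K) : d.-tuple K :=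
  [tuple tnth u k - tnth v k | k < d].

Definition vec0 (K : zmodType) (d : nat) : d.-tuple K := [tuple 0 | k < d].

Definition cvec (R : realType) (d : nat) (x y : d.-tuple R) : d.-tuple R[i] :=
  [tuple (tnth x k) +i* (tnth y k) | k < d].

Definition imC (R : realType) : R[i] := 0 +i* 1.

Definition rvec (R : realType) (d : nat) (x : d.-tuple R) : d.-tuple R[i] :=
  [tuple (tnth x k)%:C | k < d].

Lemma measurable_dotp (R : realType) (d : nat) (r : d.-tuple R) :
  measurable_fun [set: d.-tuple R] (dotp r).
Proof.
apply: measurable_sum => i; apply: measurable_funM => //.
exact: measurable_tnth.
Qed.

Section lebesgue_step.
Variables (R : realType) (n : nat)
  (m : {sigma_finite_measure set (n.-tuple R) -> \bar R}).

Let idR : measurableTypeR R -> R := idfun.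

Definition consp (p : measurableTypeR R * n.-tuple R) : n.+1.-tuple R :=
  [tuple of idR p.1 :: p.2].

Definition leb_step : set (n.+1.-tuple R) -> \bar R :=
  pushforward (lebesgue_measure \x m)%E consp.

Let unconsp (x : n.+1.-tuple R) : measurableTypeR R * n.-tuple R :=
  (thead x, [tuple of behead x]).

Let mconsp : measurable_fun setT consp.
Proof.
apply: measurable_cons; last exact: measurable_snd.
by apply: (@measurableT_comp _ _ _ _ _ _ idR) => // _ Y mY; rewrite setTI.
Qed.

Let munconsp : measurable_fun setT unconsp.
Proof.
apply: measurable_fun_pair; last exact: measurable_behead.
have : measurable_fun setT (fun x : n.+1.-tuple R => thead x).
  exact: measurable_tnth.
by [].
Qed.

Let conspK : cancel consp unconsp.
Proof.
by move=> [x t]; rewrite /unconsp /consp /=; congr pair; exact: val_inj.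
Qed.

Let leb_step0 : leb_step set0 = 0%E.
Proof. by rewrite /leb_step /pushforward preimage_set0 measure0. Qed.

Let leb_step_ge0 A : (0 <= leb_step A)%E.
Proof. exact: measure_ge0. Qed.

Let leb_step_sigma_additive : semi_sigma_additive leb_step.
Proof.
move=> F mF tF mUF; rewrite /leb_step /pushforward preimage_bigcup.
apply: measure_semi_sigma_additive.
- by move=> k; rewrite -[X in measurable X]setTI; exact: mconsp.
- apply/trivIsetP => /= i j _ _ ij; rewrite -preimage_setI.
  by move/trivIsetP : tF => /(_ _ _ _ _ ij) ->//; rewrite preimage_set0.
- by rewrite -preimage_bigcup -[X in measurable X]setTI; exact: mconsp.
Qed.

HB.instance Definition _ := isMeasure.Build _ _ _ leb_step
  leb_step0 leb_step_ge0 leb_step_sigma_additive.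

Let leb_step_sigma_finite : sigma_finite setT leb_step.
Proof.
have [F FT Ffin] : sigma_finite setT (lebesgue_measure \x m)%E.
  have /sigma_finiteP[F [TF ndF Foo]] := sigma_finiteT (@lebesgue_measure R).
  have /sigma_finiteP[G [TG ndG Goo]] := sigma_finiteT m.
  exists (fun k => F k `*` G k).
    rewrite -setXTT TF TG predeqE => -[x y]; split.
      move=> [/= [i _ Fix] [j _ Gjy]]; exists (maxn i j) => //; split.
      - by move: x Fix; exact/subsetPset/ndF/leq_maxl.
      - by move: y Gjy; exact/subsetPset/ndG/leq_maxr.
    by move=> [i _ []/= ? ?]; split; exists i.
  move=> k; have [? ?] := Foo k; have [? ?] := Goo k.
  split; first exact: measurableX.
  by rewrite product_measure1E// lte_mul_pinfty// ge0_fin_numE.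
exists (fun k => unconsp @^-1` F k).
  by rewrite -preimage_bigcup -FT preimage_setT.
move=> k; have [mF Foo] := Ffin k; split.
  by rewrite -[X in measurable X]setTI; exact: munconsp.
rewrite /leb_step /pushforward -comp_preimage.
rewrite (_ : unconsp \o consp = id) ?preimage_id//.
by apply/funext => x /=; rewrite conspK.
Qed.

HB.instance Definition _ := Measure_isSigmaFinite.Build _ _ _ leb_step
  leb_step_sigma_finite.

End lebesgue_step.

Fixpoint leb (R : realType) (d : nat) :
    {sigma_finite_measure set (d.-tuple R) -> \bar R} :=
  if d is n.+1 return {sigma_finite_measure set (d.-tuple R) -> \bar R}
  then leb_step (leb R n) else dirac [tuple].

Definition expC (R : realType) (z : R[i]) : R[i] :=
  let: a +i* b := z in (expR a * cos b) +i* (expR a * sin b).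

Section complex_integral.
Context {disp : measure_display} {E : measurableType disp} {R : realType}.
Variables (mu : set E -> \bar R) (f : E -> R[i]).

(* f is in L^1(mu): measurable with integrable modulus *)
Definition cintegrable : Prop :=
  [/\ measurable_fun [set: E] (fun x => complex.Re (f x)),
      measurable_fun [set: E] (fun x => complex.Im (f x)) &
      (\int[mu]_x (Normc.normc (f x))%:E < +oo)%E].

(* only meaningful under [cintegrable] *)
Definition cintegral : R[i] :=
  fine (\int[mu]_x (complex.Re (f x))%:E)%E +i*
  fine (\int[mu]_x (complex.Im (f x))%:E)%E.

End complex_integral.

Section fourier.
Variables (R : realType) (d : nat) (f : d.-tuple R -> R) (z : d.-tuple R[i]).

Definition fourier_kernel (x : d.-tuple R) : R[i] :=
  expC (imC R * dotp z (rvec x)) * (f x)%:C.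

Definition fourier_defined : Prop := cintegrable (leb R d) fourier_kernel.

Definition fourier : R[i] := cintegral (leb R d) fourier_kernel.

End fourier.

Section mgf.
Context {disp : measure_display} {Omega : measurableType disp} {R : realType}.
Variables (P : probability Omega R) (d : nat) (X : Omega -> d.-tuple R).
Variable z : d.-tuple R[i].

Definition mgf_defined : Prop :=
  cintegrable P (fun w => expC (dotp z (rvec (X w)))).

Definition mgf : R[i] := cintegral P (fun w => expC (dotp z (rvec (X w)))).

End mgf.

Section tilted.
Variables (R : realType) (d : nat) (r : d.-tuple R).
Variable mu : {measure set (d.-tuple R) -> \bar R}.

Definition tilted (A : set (d.-tuple R)) : \bar R :=
  (\int[mu]_(x in A) (expR (dotp r x))%:E)%E.

Let tilted0 : tilted set0 = 0%E.
Proof. exact: integral_set0. Qed.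

Let tilted_ge0 A : (0 <= tilted A)%E.
Proof. by apply: integral_ge0 => x _; rewrite lee_fin expR_ge0. Qed.

Let tilted_sigma_additive : semi_sigma_additive tilted.
Proof.
apply: semi_sigma_additive_nng_induced.
  by apply/measurable_EFinP; apply: measurableT_comp => //; exact: measurable_dotp.
by move=> x; rewrite lee_fin expR_ge0.
Qed.

HB.instance Definition _ := isMeasure.Build _ _ _ tilted
  tilted0 tilted_ge0 tilted_sigma_additive.

End tilted.

Definition fourier_measure (R : realType) (d : nat)
    (m : set (d.-tuple R) -> \bar R) (u : d.-tuple R) : R[i] :=
  cintegral m (fun x => expC (imC R * (dotp u x)%:C)).

Definition price {disp : measure_display} {Omega : measurableType disp}
    {R : realType} (P : probability Omega R) (d : nat)
    (f : d.-tuple R -> R) (X : Omega -> d.-tuple R) (s : d.-tuple R) : \bar R :=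
  'E_P[fun w => f (subt (X w) s)]%E.

(** Stochastic analysis on [[0, T]], following Jacod and Shiryaev, "Limit
    theorems for stochastic processes", Chapters I and II.  A process is a
    function of time [t : R] and [w : Omega]; only its values for t in [[0, T]]
    matter.  The filtration is right-continuous but not assumed complete, and
    path properties are required almost surely. *)

Section paths.
Variables (R : realType) (T : R).

Definition cadlag (x : R -> R) : Prop :=
  (forall t, 0 <= t -> t < T -> x s @[s --> t^'+] --> x t) /\
  (forall t, 0 < t -> t <= T -> cvg (x s @[s --> t^'-])).

Definition jump (x : R -> R) (t : R) : R := x t - lim (x s @[s --> t^'-]).

Variable d : nat.

Definition cadlag_vec (p : R -> d.-tuple R) : Prop :=
  forall j : 'I_d, cadlag (fun t => tnth (p t) j).

Definition jump_vec (p : R -> d.-tuple R) (t : R) : d.-tuple R :=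
  [tuple jump (fun s => tnth (p s) j) t | j < d].

Definition path_sigma : set (set (R -> d.-tuple R)) :=
  <<s [set C | exists t B, [/\ 0 <= t, t <= T, measurable B &
                               C = [set p : R -> d.-tuple R | B (p t)]]] >>.

(* Measurable functional of the path on [0, T]: the sigma-algebra is the trace
   of [path_sigma] on the cadlag paths, i.e. the one of the Skorokhod space. *)
Definition measurable_functional
    (Psi : (R -> d.-tuple R) -> d.-tuple R) : Prop :=
  (forall p q, (forall t, 0 <= t -> t <= T -> p t = q t) -> Psi p = Psi q) /\
  (forall B, measurable B ->
     exists2 C, path_sigma C & forall p, cadlag_vec p -> (C p <-> B (Psi p))).

Definition truncation_function (h : d.-tuple R -> d.-tuple R) : Prop :=
  [/\ measurable_fun [set: d.-tuple R] h,
      (exists M : R, forall x j, `|tnth (h x) j| <= M) &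
      (exists2 e : R, 0 < e &
        forall x, (forall j, `|tnth x j| <= e) -> h x = x)].

End paths.

Section stochastic_analysis.
Context {disp : measure_display} {Omega : measurableType disp} {R : realType}.
Variables (P : probability Omega R) (T : R) (F : R -> set (set Omega)).
Implicit Types (X Y : R -> Omega -> R) (w : Omega) (t : R).

Definition stochastic_basis : Prop :=
  [/\ forall t, 0 <= t -> t <= T -> sigma_algebra setT (F t),
      forall t, 0 <= t -> t <= T -> F t `<=` measurable,
      forall s t, 0 <= s -> s <= t -> t <= T -> F s `<=` F t &
      forall t, 0 <= t -> t < T ->
        \bigcap_(s in [set s | t < s /\ s <= T]) F s `<=` F t].

Definition adapted X : Prop :=
  forall t, 0 <= t -> t <= T ->
  forall B : set R, measurable B -> F t (X t @^-1` B).

Definition martingale X : Prop :=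
  [/\ adapted X,
      {ae P, forall w, cadlag T (X^~ w)},
      forall t, 0 <= t -> t <= T -> P.-integrable setT (EFin \o X t) &
      forall s t, 0 <= s -> s <= t -> t <= T -> forall A, F s A ->
        (\int[P]_(w in A) (X t w)%:E = \int[P]_(w in A) (X s w)%:E)%E].

Definition stopping_time (tau : Omega -> R) : Prop :=
  (forall w, 0 <= tau w /\ tau w <= T) /\
  (forall t, 0 <= t -> t <= T -> F t [set w | tau w <= t]).

Definition stopped X (tau : Omega -> R) : R -> Omega -> R :=
  fun t w => X (Num.min t (tau w)) w.

(* on [0, T], a localizing sequence is one that eventually equals T, a.s. *)
Definition local_martingale X : Prop :=
  adapted X /\
  exists tau : nat -> Omega -> R,
    [/\ forall n, stopping_time (tau n),
        forall n w, tau n w <= tau n.+1 w,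
        {ae P, forall w, exists n, tau n w = T} &
        forall n, martingale (stopped X (tau n))].

Definition continuous_local_martingale X : Prop :=
  local_martingale X /\
  {ae P, forall w, {within `[0, T], continuous (X^~ w)}}.

Definition purely_discontinuous X : Prop :=
  [/\ local_martingale X, forall w, X 0 w = 0 &
      forall Y, continuous_local_martingale Y ->
        local_martingale (fun t w => X t w * Y t w)].

Definition finite_variation_process X : Prop :=
  [/\ adapted X, forall w, X 0 w = 0 &
      {ae P, forall w, cadlag T (X^~ w) /\ bounded_variation 0 T (X^~ w)}].

Definition semimartingale X : Prop :=
  adapted X /\
  exists M A : R -> Omega -> R,
    [/\ local_martingale M, forall w, M 0 w = 0, finite_variation_process A &
        {ae P, forall w, forall t, 0 <= t -> t <= T ->
           X t w = X 0 w + M t w + A t w}].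

Let times_Omega : set (R * Omega) := `[0, T] `*` setT.

Definition predictable_sigma : set (set (R * Omega)) :=
  <<s times_Omega,
      [set C | (exists2 A, F 0 A & C = [set 0] `*` A) \/
               (exists s t A, [/\ 0 <= s, s < t, t <= T, F s A &
                                  C = `]s, t] `*` A])] >>.

Definition predictable {d' : measure_display} {E : measurableType d'}
    (Y : R -> Omega -> E) : Prop :=
  forall B, measurable B ->
    predictable_sigma (times_Omega `&` [set p | B (Y p.1 p.2)]).

Variable d : nat.

Definition predictable_fun (W : R -> Omega -> d.-tuple R -> \bar R) : Prop :=
  let D := times_Omega `*` [set: d.-tuple R] in
  forall B, measurable B ->
    <<s D, [set C | exists C1 C2, [/\ predictable_sigma C1, measurable C2 &
                                      C = C1 `*` C2]] >>
    (D `&` [set q | B (W q.1.1 q.1.2 q.2)]).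

Definition random_integral (m : Omega -> set (R * d.-tuple R) -> \bar R)
    (W : R -> Omega -> d.-tuple R -> \bar R) : R -> Omega -> \bar R :=
  fun t w => (\int[m w]_(q in `]0%R, t] `*` setT) W q.1 w q.2)%E.

Variable H : R -> Omega -> d.-tuple R.

Let dH t w : d.-tuple R := jump_vec (H^~ w) t.

Definition jump_measure w (A : set (R * d.-tuple R)) : \bar R :=
  (\esum_(s in [set s : R | [/\ 0 < s, s <= T & dH s w <> vec0 R d]%R])
     dirac (s, dH s w) A)%E.

Variable nu : Omega -> {measure set (R * d.-tuple R) -> \bar R}.

Definition jump_compensator : Prop :=
  (forall w, nu w ([set 0] `*` setT) = 0%E) /\
  forall W : R -> Omega -> d.-tuple R -> \bar R,
    (forall t w x, (0 <= W t w x)%E) -> predictable_fun W ->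
    predictable (random_integral nu W) /\
    (\int[P]_w random_integral jump_measure W T w =
     \int[P]_w random_integral nu W T w)%E.

(* N is the stochastic integral k(x) * (mu - nu), for k : R^d -> R: the purely
   discontinuous local martingale whose jumps are those of k(x) * (mu - nu) *)
Definition compensated_integral (k : d.-tuple R -> R) (N : R -> Omega -> R)
    : Prop :=
  purely_discontinuous N /\
  {ae P, forall w, forall t, 0 < t -> t <= T ->
     jump (N^~ w) t =
       (if dH t w == vec0 R d then 0 else k (dH t w)) -
       fine (\int[nu w]_(q in [set t] `*` setT) (k q.2)%:E)%E}.

End stochastic_analysis.

(* canonical representation, relative to h,
   H^j = H^j_0 + B^j + H^{j,c} + h^j(x) * (mu - nu) + (x^j - h^j(x)) * mu *)
Definition canonical_representation
    {disp : measure_display} {Omega : measurableType disp} {R : realType}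
    (P : probability Omega R) (T : R) (F : R -> set (set Omega)) (d : nat)
    (H : R -> Omega -> d.-tuple R) (h : d.-tuple R -> d.-tuple R)
    (B Hc : 'I_d -> R -> Omega -> R)
    (nu : Omega -> {measure set (R * d.-tuple R) -> \bar R}) : Prop :=
  jump_compensator P T F H nu /\
  forall j : 'I_d,
    [/\ predictable T F (B j) /\ finite_variation_process P T F (B j),
        continuous_local_martingale P T F (Hc j),
        (forall w, Hc j 0 w = 0) &
        exists2 N,
          compensated_integral P T F H nu (fun x => tnth (h x) j) N &
          {ae P, forall w, forall t, 0 <= t -> t <= T ->
             tnth (H t w) j =
               tnth (H 0 w) j + B j t w + Hc j t w + N t w +
               fine (random_integral (jump_measure T H)
                       (fun _ _ x => (tnth x j - tnth (h x) j)%:E) t w)}].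

(* Main.v *)
(* The price is [E (f (X - s)) = e^(-<r, s>) \int g (x - s) rho (dx)], so what is
   needed is that rho has the density given by Fourier inversion; Fubini and a
   translation then produce the formula. For the inversion, rho is convolved with
   the product Cauchy kernel, whose Fourier transform is the Laplace kernel
   [e^(-eps |u|_1)]; both one-dimensional integrals are elementary. As eps goes to
   0 the regularized inverse transforms converge boundedly to the inverse transform
   of rho, while their integrals over boxes, which are products of differences of
   arctangents averaged against rho, converge to the rho-measure of the boxes. *)

Require Import Defs.
From HB Require Import structures.
From mathcomp Require Import all_boot all_order all_algebra.
From mathcomp Require Import all_classical all_reals all_analysis.
From mathcomp Require Import measurable_realfun ring lra.
From mathcomp Require Import complex.

Set Implicit Arguments.
Unset Strict Implicit.
Unset Printing Implicit Defensive.

Import Order.TTheory GRing.Theory Num.Theory.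
Import numFieldTopology.Exports numFieldNormedType.Exports.

Local Open Scope classical_set_scope.
Local Open Scope ring_scope.
Local Open Scope complex_scope.

(** * Cauchy and Laplace kernels on the line *)

(** The payoff is only measurable and the formula is claimed at every s, so recovering a function
    almost everywhere is not enough: inversion is stated as an equality of measures, tested on
    half-open boxes and extended to all Borel sets.

    The Cauchy kernel has a second merit besides being explicit: it is nonnegative. The regularized
    inverse transforms are averages of it against rho, so their limit is nonnegative too, which an
    oscillatory integral does not show. The candidate density therefore defines a measure, and since
    f is also nonnegative the price can be rewritten through the density before it is known to be
    finite. Finiteness is read off at the end from the integrability of the transformed side.

    Complex integrals are handled through real and imaginary parts throughout. The imaginary part of
    the inverse transform vanishes because every regularized version of it is the integral of an odd
    kernel. The factor (2 pi)^d is the mass of the unnormalized Cauchy kernel, 2 (pi/2 + pi/2) in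
    each coordinate. *)

Section one_dim.
Context {R : realType}.
Let mu := @lebesgue_measure R.

Lemma sqrD_gt0 (e t : R) : 0 < e -> 0 < e ^+ 2 + t ^+ 2.
Proof. by move=> e0; rewrite ltr_pwDl ?sqr_ge0 ?exprn_gt0. Qed.

Lemma continuous_expRNnorm (e : R) : continuous (fun u : R => expR (- e * `|u|)).
Proof.
move=> u; apply: (@continuous_comp _ _ _ (fun u : R => - e * `|u|) expR).
  by apply: cvgM; [exact: cvg_cst|exact: norm_continuous].
exact: continuous_expR.
Qed.

Lemma continuous_cosM (t : R) : continuous (fun u : R => cos (u * t)).
Proof.
move=> u; apply: (@continuous_comp _ _ _ (fun u : R => u * t) cos);
  last exact: continuous_cos.
by apply: cvgM; [exact: cvg_id|exact: cvg_cst].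
Qed.

(* Adding 1 to the cosine makes the integrand nonnegative, as the improper
   fundamental theorem of calculus requires. *)
Lemma integral_laplace_1Dcos (e t : R) : 0 < e ->
  (\int[mu]_u (expR (- e * `|u|) * (1 + cos (u * t)))%:E =
   (2 / e + 2 * e / (e ^+ 2 + t ^+ 2))%:E)%E.
Proof.
move=> e0.
have cf : continuous (fun u : R => expR (- e * `|u|) * (1 + cos (u * t))).
  move=> u; apply: cvgM; first exact: continuous_expRNnorm.
  by apply: cvgD; [exact: cvg_cst|exact: continuous_cosM].
have f0 (u : R) : 0 <= expR (- e * `|u|) * (1 + cos (u * t)).
  by rewrite mulr_ge0 ?expR_ge0//; have := cos_geN1 (u * t); lra.
rewrite ge0_symfun_integralT//; last first.
  by move=> u /=; rewrite normrN (mulNr u) cosN.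
(* The antiderivative that vanishes at +oo, so that the half-line integral is [- F 0], that is 1/e +
   e/(e^2 + t^2). *)
pose F (u : R) := expR (- e * u) * (- e^-1 + (t * sin (u * t) - e * cos (u * t)) / (e ^+ 2 + t ^+ 2)).
have dF (u : R) : is_derive u 1 F (expR (- e * u) * (1 + cos (u * t))).
  rewrite /F.
  apply: is_derive_eq.
  rewrite /GRing.scale/=.
  have := sqrD_gt0 t e0.
  move: (sin _) (cos _) (expR _) => S C E h.
  field.
  by rewrite (gt_eqF h) (gt_eqF e0).
rewrite -set_itvcy.
transitivity (2%:E * \int[mu]_(u in `[0%R, +oo[) (expR (- e * u) * (1 + cos (u * t)))%:E)%E.
  congr (_ * _)%E; apply: eq_integral => u.
  by rewrite inE/= in_itv/= andbT => u0; rewrite ger0_norm.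
rewrite (@ge0_continuous_FTC2y _ _ F _ 0)//.
- rewrite /F mulr0 mul0r sin0 cos0 expR0 -EFinB -EFinM; congr EFin.
  by field; rewrite (gt_eqF (sqrD_gt0 t e0)) (gt_eqF e0).
- apply: continuous_subspaceT => u.
  apply: cvgM.
    apply: (@continuous_comp _ _ _ (fun u : R => - e * u) expR);
      last exact: continuous_expR.
    by apply: cvgM; [exact: cvg_cst|exact: cvg_id].
  by apply: cvgD; [exact: cvg_cst|exact: continuous_cosM].
- have FC (u : R) : `|F u| <= (e^-1 + (`|t| + e) / (e ^+ 2 + t ^+ 2)) * expR (- (e * u)).
    rewrite /F normrM (ger0_norm (expR_ge0 _)) mulNr mulrC ler_wpM2r ?expR_ge0//.
    rewrite (le_trans (ler_normD _ _))// lerD//.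
      by rewrite normrN ger0_norm ?invr_ge0 ?(ltW e0).
    rewrite normrM (@ger0_norm _ (_ ^-1)) ?invr_ge0 ?(ltW (sqrD_gt0 _ _))//.
    rewrite ler_wpM2r ?invr_ge0 ?(ltW (sqrD_gt0 _ _))//.
    rewrite (le_trans (ler_normB _ _))// lerD// normrM.
      by rewrite ler_piMr ?sin_max.
    by rewrite (gtr0_norm e0) ler_piMr ?cos_max ?(ltW e0).
  have eu0 : expR (- (e * u)) @[u --> +oo] --> (0:R).
    apply: (cvg_comp (fun u : R => e * u) (fun x => expR (- x))); last exact: cvgr_expR.
    by apply: gt0_cvgMry => //; exact: cvg_id.
  apply: norm_cvg0.
  apply: (@squeeze_cvgr _ _ _ _ (fun=> 0) (fun u => (e^-1 + (`|t| + e) / (e ^+ 2 + t ^+ 2)) * expR (- (e * u)))).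
  + by apply: nearW => u; rewrite normr_ge0 FC.
  + exact: cvg_cst.
  + by rewrite -[X in _ --> X](mulr0 (e^-1 + (`|t| + e) / (e ^+ 2 + t ^+ 2)));
      apply: cvgM => //; exact: cvg_cst.
- apply: cvg_at_right_filter.
  apply: differentiable_continuous; exact/derivable1_diffP/ex_derive.
- by move=> u _; rewrite derive1E; exact: derive_val.
Qed.

Lemma continuous_sinM (t : R) : continuous (fun u : R => sin (u * t)).
Proof.
move=> u; apply: (@continuous_comp _ _ _ (fun u : R => u * t) sin);
  last exact: continuous_sin.
by apply: cvgM; [exact: cvg_id|exact: cvg_cst].
Qed.

Lemma measurable_expRNnorm (e : R) :
  measurable_fun [set: R] (fun u : R => (expR (- e * `|u|))%:E).
Proof.
apply/measurable_EFinP; apply: continuous_measurable_fun.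
exact: continuous_expRNnorm.
Qed.

(** This is the case t = 0 of [integral_laplace_1Dcos], where 1 + cos is 2. The integral is not yet
    known to be finite, so the factor 2 is cancelled by cases on its extended value. *)
Lemma integral_laplace (e : R) : 0 < e ->
  (\int[mu]_u (expR (- e * `|u|))%:E = (2 / e)%:E)%E.
Proof.
move=> e0; have mh := measurable_expRNnorm e.
have := integral_laplace_1Dcos 0 e0.
under eq_integral do rewrite mulr0 cos0 -[1 + 1]/(2%:R) mulrC EFinM.
rewrite ge0_integralZl//.
have -> : 2 / e + 2 * e / (e ^+ 2 + 0 ^+ 2) = 2 * (2 / e) by field; rewrite gt_eqF.
rewrite EFinM; case: (\int[mu]_u _)%E => [x| |]//.
- by move=> [] /mulfI => ->.
- by rewrite mulry gtr0_sg// mul1e.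
- by rewrite mulrNy gtr0_sg// mul1e.
Qed.

Lemma integrable_laplace (e : R) (g : R -> R) : 0 < e -> continuous g ->
  (forall u, `|g u| <= 1) ->
  mu.-integrable setT (fun u => (expR (- e * `|u|) * g u)%:E).
Proof.
move=> e0 cg g1.
have mf : measurable_fun [set: R] (fun u : R => expR (- e * `|u|) * g u).
  apply: measurable_funM; apply: continuous_measurable_fun => //.
  exact: continuous_expRNnorm.
have mh := measurable_expRNnorm e.
apply: (@le_integrable _ _ _ mu _ _ _ (fun u => (expR (- e * `|u|))%:E)) => //.
- exact/measurable_EFinP.
- move=> u _; rewrite !abse_EFin lee_fin normrM ler_piMr//.
- apply/integrableP; split => //.
  under eq_integral do rewrite abse_EFin ger0_norm ?expR_ge0//.
  by rewrite integral_laplace// ltry.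
Qed.

(** With finiteness now available, the integral of the bare exponential can be subtracted from
    [integral_laplace_1Dcos]. *)
Lemma integral_laplace_cos (e t : R) : 0 < e ->
  (\int[mu]_u (expR (- e * `|u|) * cos (u * t))%:E =
   (2 * e / (e ^+ 2 + t ^+ 2))%:E)%E.
Proof.
move=> e0; have := integral_laplace_1Dcos t e0.
under eq_integral do rewrite mulrDr EFinD.
rewrite integralD//; last 2 first.
- by apply: (integrable_laplace e0) => [|u]; [exact: cst_continuous|rewrite normr1].
- by apply: (integrable_laplace e0) => [|u]; [exact: continuous_cosM|exact: cos_max].
under eq_integral do rewrite mulr1.
rewrite integral_laplace//.
rewrite -[X in (_ + X)%E]/(\int[mu]_u (expR (- e * `|u|) * cos (u * t))%:E)%E.
case: (\int[mu]_u _)%E => // x.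
by rewrite -EFinD => -[]; move=> h; congr EFin; lra.
Qed.

(** The integrand is odd and Lebesgue measure is invariant under reflection, so the integral, which
    is finite, equals its own opposite. *)
Lemma integral_laplace_sin (e t : R) : 0 < e ->
  (\int[mu]_u (expR (- e * `|u|) * sin (u * t))%:E = 0)%E.
Proof.
move=> e0.
have iS : mu.-integrable setT (fun u => (expR (- e * `|u|) * sin (u * t))%:E).
  by apply: (integrable_laplace e0) => [|u]; [exact: continuous_sinM|exact: sin_max].
have h : (\int[mu]_u (expR (- e * `|u|) * sin (u * t))%:E =
  - \int[mu]_u (expR (- e * `|u|) * sin (u * t))%:E)%E.
  transitivity (\int[pushforward mu (-%R : measurableTypeR R -> measurableTypeR R)]_u (expR (- e * `|u|) * sin (u * t))%:E)%E.
    by apply: eq_measure_integral => A mA _; exact/esym/lebesgue_measureN.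
  rewrite integral_pushforward//; last 2 first.
  - by case/integrableP : iS.
  - have := integrableN iS; rewrite preimage_setT; apply: eq_integrable => // u _ /=.
    by rewrite normrN (mulNr u) sinN mulrN.
  rewrite preimage_setT -integralN//; last first.
    exact: integrable_add_def.
  by apply: eq_integral => u _ /=; rewrite normrN (mulNr u) sinN mulrN EFinN.
move: h; have := integrable_fin_num measurableT iS.
by case: (\int[mu]_u _)%E => // x _ []/eqP;
  rewrite -subr_eq0 opprK -mulr2n mulrn_eq0/= => /eqP ->.
Qed.

Lemma continuous_cauchy (e : R) : 0 < e ->
  continuous (fun t : R => 2 * e / (e ^+ 2 + t ^+ 2)).
Proof.
move=> e0 x; apply: cvgM; first exact: cvg_cst.
apply: cvgV; first by rewrite gt_eqF ?sqrD_gt0.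
apply: cvgD; first exact: cvg_cst.
rewrite expr2; under eq_cvg do rewrite expr2.
by apply: cvgM; exact: cvg_id.
Qed.

Lemma integral_cauchy (e a b y : R) : 0 < e -> a < b ->
  (\int[mu]_(x in `]a, b]) (2 * e / (e ^+ 2 + (y - x) ^+ 2))%:E =
   (2 * (atan ((b - y) / e) - atan ((a - y) / e)))%:E)%E.
Proof.
move=> e0 ab.
have cf : continuous (fun x : R => 2 * e / (e ^+ 2 + (y - x) ^+ 2)).
  move=> x; apply: (@continuous_comp _ _ _ (fun x : R => y - x)
    (fun t : R => 2 * e / (e ^+ 2 + t ^+ 2))); last exact: continuous_cauchy.
  by apply: cvgB; [exact: cvg_cst|exact: cvg_id].
(* The kernel is even in y - x, and its antiderivative in x is an arctangent rescaled by e. *)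
pose F (x : R) := 2 * atan ((x - y) / e).
have dF (x : R) : is_derive x 1 F (2 * e / (e ^+ 2 + (y - x) ^+ 2)).
  rewrite /F.
  apply: is_derive_eq.
  rewrite /GRing.scale/=.
  have h1 := sqrD_gt0 (y - x) e0.
  field.
  by rewrite (gt_eqF h1) (gt_eqF e0).
have cF : continuous F.
  by move=> x; apply: differentiable_continuous; exact/derivable1_diffP/ex_derive.
rewrite integral_itv_obnd_cbnd//; last first.
  apply/measurable_EFinP/measurable_funTS; exact: continuous_measurable_fun.
rewrite (@continuous_FTC2 _ _ F)//.
- by rewrite /F -EFinB mulrBr.
- exact: continuous_subspaceT.
- split => //.
  + exact/cvg_at_right_filter/cF.
  + exact/cvg_at_left_filter/cF.
- by move=> u _; rewrite derive1E; exact: derive_val.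
Qed.

(** With N = n + 1 the argument of [atan] is (b - y) N^2 + N. At y = b the linear term alone drives
    it to +oo, which puts the endpoint on the side of y < b; for y > b the quadratic term wins. *)
Lemma cvg_atan_step (b y : R) :
  atan ((b + n.+1%:R^-1 - y) / n.+1%:R^-2) @[n --> \oo] -->
  (if y <= b then pi / 2 else - (pi / 2)).
Proof.
have ny : (fun n => n.+1%:R : R) @ \oo --> +oo.
  by have := @cvgr_idn R; rewrite -(cvg_shiftS (fun n => n%:R : R)).
have dy (c : R) : 0 < c -> (fun n => c * n.+1%:R) @ \oo --> +oo.
  move=> c0; apply: (cvg_comp (fun n => n.+1%:R) (fun x : R => c * x)).
    exact: ny.
  by apply: gt0_cvgMry => //; exact: cvg_id.
case: ifPn => yb.
  apply: (cvg_comp (fun n => (b + n.+1%:R^-1 - y) / n.+1%:R^-2) (@atan R));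
    last exact: cvgy_atan.
  apply: (@ger_cvgy _ _ _ _ (fun n => 1 * n.+1%:R)); last exact: dy.
  apply: nearW => n; rewrite mul1r invrK expr2 mulrA.
  rewrite -[leLHS]mul1r ler_wpM2r//.
  have h : (0:R) < n.+1%:R by [].
  by rewrite -ler_pdivrMr// div1r; move: (n.+1%:R^-1) => i; lra.
rewrite -ltNge in yb.
have -> : (fun n => atan ((b + n.+1%:R^-1 - y) / n.+1%:R^-2)) =
          (fun n => - atan ((y - b - n.+1%:R^-1) / n.+1%:R^-2)).
  by apply/funext => n; rewrite -atanN -mulNr; congr (atan (_ / _)); ring.
apply: cvgN.
apply: (cvg_comp (fun n => (y - b - n.+1%:R^-1) / n.+1%:R^-2) (@atan R));
  last exact: cvgy_atan.
(* Once 1/N is below (y - b)/2 the numerator is at least (y - b)/2, and N^2 is at least N. *)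
apply: (@ger_cvgy _ _ _ _ (fun n => (y - b) / 2 * n.+1%:R)); last by apply: dy;
  rewrite divr_gt0// subr_gt0.
have hn : \forall n \near \oo, n.+1%:R^-1 < (y - b) / 2.
  have h : 0 < (y - b) / 2 by rewrite divr_gt0// subr_gt0.
  exact: (near_infty_natSinv_lt (PosNum h)).
near=> n.
have n0 : (0:R) < n.+1%:R by [].
have n1 : (1:R) <= n.+1%:R by rewrite ler1n.
have hh : n.+1%:R^-1 < (y - b) / 2 by near: n.
rewrite invrK expr2 mulrA.
rewrite ler_wpM2r//.
by move: (n.+1%:R : R) (n.+1%:R^-1) hh n1 => m i hh n1; nra.
Unshelve. all: by end_near. Qed.
End one_dim.

(** * Lebesgue measure on tuples *)

Section tuples.
Context {R : realType}.
Let mu := @lebesgue_measure R.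

Lemma measurable_consp n : measurable_fun [set: measurableTypeR R * n.-tuple R] (@consp R n).
Proof.
apply: measurable_cons; last exact: measurable_snd.
by apply: (@measurableT_comp _ _ _ _ _ _ (idfun : measurableTypeR R -> R)) => // _ Y mY;
  rewrite setTI.
Qed.

Lemma ge0_integral_leb_step n (F : n.+1.-tuple R -> \bar R) :
  measurable_fun [set: n.+1.-tuple R] F -> (forall x, 0 <= F x)%E ->
  (\int[leb R n.+1]_x F x = \int[mu]_x \int[leb R n]_t F (consp (x, t)))%E.
Proof.
move=> mF F0.
transitivity (\int[pushforward (mu \x leb R n)%E (@consp R n)]_x F x)%E; first by [].
rewrite ge0_integral_pushforward//; last exact: measurable_consp.
rewrite preimage_setT fubini_tonelli1//.
- by apply: measurableT_comp => //; exact: measurable_consp.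
- by move=> x /=.
Qed.

(** Integrability comes from Tonelli applied to absolute values, where the iterated integral factors
    into two finite numbers; Fubini then factors the signed integral. *)
Lemma integral_tensor d1 d2 (T1 : measurableType d1) (T2 : measurableType d2)
  (m1 : {sigma_finite_measure set T1 -> \bar R})
  (m2 : {sigma_finite_measure set T2 -> \bar R}) (a : T1 -> R) (b : T2 -> R) :
  m1.-integrable setT (EFin \o a) -> m2.-integrable setT (EFin \o b) ->
  (m1 \x m2)%E.-integrable setT (fun z => (a z.1 * b z.2)%:E) /\
  (\int[m1 \x m2]_z (a z.1 * b z.2)%:E =
   \int[m1]_x (a x)%:E * \int[m2]_y (b y)%:E)%E.
Proof.
move=> ia ib.
have ma : measurable_fun setT a by apply/measurable_EFinP; case/integrableP : ia.
have mb : measurable_fun setT b by apply/measurable_EFinP; case/integrableP : ib.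
have mab : measurable_fun setT (fun z : T1 * T2 => (a z.1 * b z.2)%:E).
  by apply/measurable_EFinP/measurable_funM; exact: measurableT_comp.
have iab : (m1 \x m2)%E.-integrable setT (fun z => (a z.1 * b z.2)%:E).
  apply/(integrable12ltyP _ _ mab) => /=.
  under eq_integral => x _.
    under eq_integral => y _ do rewrite normrM EFinM.
    rewrite ge0_integralZl//; last by apply/measurable_EFinP; exact: measurableT_comp.
    over.
  have ib' := integrable_abse ib.
  have fb : (\int[m2]_y `|(b y)%:E| \is a fin_num)%E := integrable_fin_num measurableT ib'.
  rewrite ge0_integralZr//=.
  - by rewrite ltey_eq fin_numM//; exact: (integrable_fin_num measurableT (integrable_abse ia)).
  - by apply/measurable_EFinP; exact: measurableT_comp.
  - exact: integral_ge0.
split => //.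
rewrite -integral12_prod_meas1//= /fubini_F.
under eq_integral => x _.
  under eq_integral => y _ do rewrite EFinM /=.
  rewrite integralZl//.
  over.
have fb : (\int[m2]_y (b y)%:E \is a fin_num)%E := integrable_fin_num measurableT ib.
by rewrite -(fineK fb) integralZr.
Qed.

Lemma leb_tensor n (a : R -> R) (b : n.-tuple R -> R) :
  mu.-integrable setT (EFin \o a) -> (leb R n).-integrable setT (EFin \o b) ->
  (leb R n.+1).-integrable setT (fun x => (a (thead x) * b [tuple of behead x])%:E) /\
  (\int[leb R n.+1]_x (a (thead x) * b [tuple of behead x])%:E =
   \int[mu]_x (a x)%:E * \int[leb R n]_y (b y)%:E)%E.
Proof.
move=> ia ib; have [iab abE] := integral_tensor ia ib.
have ma : measurable_fun setT a by apply/measurable_EFinP; case/integrableP : ia.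
have mb : measurable_fun setT b by apply/measurable_EFinP; case/integrableP : ib.
have mF : measurable_fun [set: n.+1.-tuple R] (fun x => (a (thead x) * b [tuple of behead x])%:E).
  apply/measurable_EFinP/measurable_funM.
    by apply: measurableT_comp => //; exact: measurable_tnth.
  by apply: measurableT_comp => //; exact: measurable_behead.
have FE : (fun x => (a (thead x) * b [tuple of behead x])%:E) \o @consp R n =
          (fun z => (a z.1 * b z.2)%:E).
  apply/funext => -[x t] /=; congr (_ * b _)%:E.
  exact: val_inj.
have iF : (mu \x leb R n)%E.-integrable (@consp R n @^-1` setT)
    ((fun x => (a (thead x) * b [tuple of behead x])%:E) \o @consp R n).
  by rewrite FE preimage_setT.
split.
  have h := integrable_pushforward (@measurable_consp n) mF iF measurableT.
  exact: h.
rewrite -abE -FE.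
by rewrite -[LHS]/(\int[pushforward (mu \x leb R n)%E (@consp R n)]_x _)%E
  (integral_pushforward (@measurable_consp n) mF iF) ?preimage_setT.
Qed.

Lemma integral_leb0 (F : 0.-tuple R -> \bar R) :
  (\int[leb R 0]_x F x = F [tuple])%E.
Proof.
rewrite -[LHS]/(\int[\d_[tuple]]_x F x)%E integral_dirac//.
  by rewrite diracT mul1e.
(* The space has a single point, so a preimage is either everything or empty. *)
move=> _ Y mY; rewrite setTI.
have [h|h] := boolP ([tuple] \in F @^-1` Y).
  rewrite (_ : F @^-1` Y = setT); first exact: measurableT.
  by apply/seteqP; split => // x _; rewrite (tuple0 x); exact: set_mem.
rewrite (_ : F @^-1` Y = set0); first exact: measurable0.
by apply/seteqP; split => // x; rewrite (tuple0 x) => /mem_set; rewrite (negbTE h).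
Qed.

Lemma tnth_behead_lift T n (x : n.+1.-tuple T) (i : 'I_n) :
  tnth [tuple of behead x] i = tnth x (lift ord0 i).
Proof. by case/tupleP : x => x t; rewrite tnthS; congr tnth; exact: val_inj. Qed.

Lemma integral_leb_prod n (phi : 'I_n -> R -> R) (c : 'I_n -> R) :
  (forall k, mu.-integrable setT (EFin \o phi k)) ->
  (forall k, \int[mu]_x (phi k x)%:E = (c k)%:E)%E ->
  (leb R n).-integrable setT (fun x => (\prod_(k < n) phi k (tnth x k))%:E) /\
  (\int[leb R n]_x (\prod_(k < n) phi k (tnth x k))%:E = (\prod_(k < n) c k)%:E)%E.
Proof.
elim: n phi c => [phi c _ _|n IH phi c iphi Iphi].
  rewrite integral_leb0 !big_ord0; split => //.
  apply/integrableP; split; first by under eq_fun do rewrite big_ord0;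
    exact: measurable_cst.
  by rewrite integral_leb0 big_ord0 ltry.
have [i1 I1] := IH (fun k => phi (lift ord0 k)) (fun k => c (lift ord0 k))
   (fun k => iphi _) (fun k => Iphi _).
have [i2 I2] := leb_tensor (iphi ord0) i1.
have E : (fun x : n.+1.-tuple R => (\prod_(k < n.+1) phi k (tnth x k))%:E) =
   (fun x => (phi ord0 (thead x) * \prod_(k < n) phi (lift ord0 k) (tnth [tuple of behead x] k))%:E).
  apply/funext => x; rewrite big_ord_recl; congr (_ * _)%:E.
  by apply: eq_bigr => k _; rewrite tnth_behead_lift.
by rewrite E; split => //; rewrite I2 Iphi I1 big_ord_recl EFinM.
Qed.

Definition laplace_kernel n (e : R) (u : n.-tuple R) : R :=
  expR (- e * \sum_(k < n) `|tnth u k|).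

Lemma laplace_kernel_ge0 n e (u : n.-tuple R) : 0 <= laplace_kernel e u.
Proof. exact: expR_ge0. Qed.

Lemma laplace_kernel_le1 n e (u : n.-tuple R) : 0 <= e -> laplace_kernel e u <= 1.
Proof.
by move=> e0; rewrite -[leRHS]expR0 ler_expR mulNr oppr_le0 mulr_ge0// sumr_ge0.
Qed.

Lemma dotp_recl n (u t : n.+1.-tuple R) :
  dotp u t = thead u * thead t + dotp [tuple of behead u] [tuple of behead t].
Proof.
by rewrite /dotp big_ord_recl; congr +%R; apply: eq_bigr => k _;
  rewrite !tnth_behead_lift.
Qed.

Lemma laplace_kernel_recl n e (u : n.+1.-tuple R) :
  laplace_kernel e u = expR (- e * `|thead u|) * laplace_kernel e [tuple of behead u].
Proof.
rewrite /laplace_kernel big_ord_recl mulrDr expRD; congr (_ * expR (_ * _)).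
by apply: eq_bigr => k _; rewrite !tnth_behead_lift.
Qed.

(** The addition formulas for the first coordinate and the rest mix cosine and sine, so both
    integrals go through one induction, along with the integrability that lets the sums be split. As
    the sine integrals vanish, only the product of cosines survives. *)
Lemma integral_laplace_kernel n (e : R) (t : n.-tuple R) : 0 < e ->
  [/\ (leb R n).-integrable setT (fun u => (laplace_kernel e u * cos (dotp u t))%:E),
      (leb R n).-integrable setT (fun u => (laplace_kernel e u * sin (dotp u t))%:E),
      (\int[leb R n]_u (laplace_kernel e u * cos (dotp u t))%:E =
       (\prod_(k < n) (2 * e / (e ^+ 2 + tnth t k ^+ 2)))%:E)%E &
      (\int[leb R n]_u (laplace_kernel e u * sin (dotp u t))%:E = 0)%E].
Proof.
move=> e0; elim: n t => [t|n IH t].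
  have E0 (u : 0.-tuple R) : dotp u t = 0 by rewrite /dotp big_ord0.
  have E1 (u : 0.-tuple R) : laplace_kernel e u = 1.
    by rewrite /laplace_kernel big_ord0 mulr0 expR0.
  have EC : (fun u : 0.-tuple R => (laplace_kernel e u * cos (dotp u t))%:E) = cst 1%E.
    by apply/funext => u; rewrite E0 E1 cos0 mul1r.
  have ES : (fun u : 0.-tuple R => (laplace_kernel e u * sin (dotp u t))%:E) = cst 0%E.
    by apply/funext => u; rewrite E0 E1 sin0 mulr0.
  rewrite EC ES !integral_leb0 big_ord0; split => //; last exact: integrable0.
  apply/integrableP; split; first exact: measurable_cst.
  by rewrite integral_leb0/= normr1 ltry.
have iC := integrable_laplace e0 (@continuous_cosM R (thead t)) (fun u => cos_max _).
have iS := integrable_laplace e0 (@continuous_sinM R (thead t)) (fun u => sin_max _).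
have [iC' iS' IC IS] := IH [tuple of behead t].
have [iCC ICC] := leb_tensor iC iC'.
have [iCS ICS] := leb_tensor iC iS'.
have [iSC ISC] := leb_tensor iS iC'.
have [iSS ISS] := leb_tensor iS iS'.
have EC : (fun u : n.+1.-tuple R => (laplace_kernel e u * cos (dotp u t))%:E) =
  (fun u => (expR (- e * `|thead u|) * cos (thead u * thead t) *
    (laplace_kernel e [tuple of behead u] * cos (dotp [tuple of behead u] [tuple of behead t])))%:E -
    (expR (- e * `|thead u|) * sin (thead u * thead t) *
    (laplace_kernel e [tuple of behead u] * sin (dotp [tuple of behead u] [tuple of behead t])))%:E)%E.
  apply/funext => u; rewrite laplace_kernel_recl dotp_recl cosD -EFinB; congr EFin; ring.
have ES : (fun u : n.+1.-tuple R => (laplace_kernel e u * sin (dotp u t))%:E) =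
  (fun u => (expR (- e * `|thead u|) * sin (thead u * thead t) *
    (laplace_kernel e [tuple of behead u] * cos (dotp [tuple of behead u] [tuple of behead t])))%:E +
    (expR (- e * `|thead u|) * cos (thead u * thead t) *
    (laplace_kernel e [tuple of behead u] * sin (dotp [tuple of behead u] [tuple of behead t])))%:E)%E.
  apply/funext => u; rewrite laplace_kernel_recl dotp_recl sinD -EFinD; congr EFin; ring.
rewrite EC ES; split.
- exact: integrableB.
- exact: integrableD.
- rewrite integralB// ICC ISS IC IS mule0 sube0 integral_laplace_cos// -EFinM; congr EFin.
  by rewrite big_ord_recl; congr (_ * _); apply: eq_bigr => k _; rewrite tnth_behead_lift.
- by rewrite integralD// ISC ICS IS mule0 adde0 integral_laplace_sin// mul0e.
Qed.

(** Lebesgue measure is characterized by its values on half-open intervals, and its image under a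
    translation has the same values there. *)
Lemma integral_translation (F : R -> \bar R) (s : R) :
  measurable_fun [set: R] F -> (forall x, 0 <= F x)%E ->
  (\int[mu]_x F (x - s)%R = \int[mu]_x F x)%E.
Proof.
move=> mF F0.
pose phi : measurableTypeR R -> measurableTypeR R := fun x => x - s.
have mphi : measurable_fun [set: measurableTypeR R] phi.
  by apply: measurable_funB => //; exact: measurable_cst.
transitivity (\int[pushforward mu phi]_x F x)%E.
  by rewrite ge0_integral_pushforward// preimage_setT.
apply: eq_measure_integral => A mA _; apply/esym.
apply: lebesgue_measure_unique => //= _ [[a b]] _ <-.
rewrite /pushforward/=.
rewrite (_ : phi @^-1` _ = `]a + s, b + s]%classic).
  by rewrite !lebesgue_measure_itv/= !lte_fin ltrD2r; case: ifP => // _; rewrite -!EFinB;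
    congr EFin; ring.
by apply/seteqP; split => x /=; rewrite !in_itv/= /phi ltrBrDr lerBlDr.
Qed.

Lemma measurable_subt n (s : n.-tuple R) :
  measurable_fun [set: n.-tuple R] (fun x => subt x s).
Proof.
apply/measurable_fun_tnthP => i.
rewrite (_ : _ \o _ = fun x => tnth x i - tnth s i); last by apply/funext => x /=;
  rewrite tnth_mktuple.
apply: measurable_funB; [exact: measurable_tnth|exact: measurable_cst].
Qed.

(** Since [leb] is an iterated product, the shift is undone one coordinate at a time: the tail by
    induction, the head by [integral_translation]. *)
Lemma ge0_integral_leb_translation n (F : n.-tuple R -> \bar R) (s : n.-tuple R) :
  measurable_fun [set: n.-tuple R] F -> (forall x, 0 <= F x)%E ->
  (\int[leb R n]_x F (subt x s) = \int[leb R n]_x F x)%E.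
Proof.
elim: n F s => [F s _ _|n IH F s mF F0].
  by rewrite !integral_leb0; congr F; rewrite tuple0.
have mFs : measurable_fun [set: n.+1.-tuple R] (fun x => F (subt x s)).
  by apply: (measurableT_comp mF); exact: measurable_subt.
rewrite !ge0_integral_leb_step//.
have E (x : R) t : subt (consp (x, t)) s = consp (x - thead s, subt t [tuple of behead s]).
  apply: eq_from_tnth => i; rewrite tnth_mktuple.
  case: (unliftP ord0 i) => [j|] ->; last by [].
  by rewrite !tnthS tnth_mktuple tnth_behead_lift.
have mc (x : R) : measurable_fun [set: n.-tuple R] (fun t => F (consp (x, t))).
  apply: (measurableT_comp mF).
  by apply: measurable_cons; [exact: measurable_cst|exact: measurable_id].
transitivity (\int[mu]_x \int[leb R n]_t F (consp ((x - thead s)%R, t)))%E.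
  apply: eq_integral => x _; rewrite -(IH (fun t => F (consp (x - thead s, t))) [tuple of behead s])//.
  by apply: eq_integral => t _; rewrite E.
rewrite (@integral_translation (fun x => \int[leb R n]_t F (consp (x, t)))%E)//.
- apply: (measurable_fun_fubini_tonelli_F (fun z : measurableTypeR R * n.-tuple R => F (consp z))) => //.
  by apply: (measurableT_comp mF); exact: measurable_consp.
- by move=> x; exact: integral_ge0.
Qed.

(** * Half-open boxes determine a measure *)

Definition box n (a b : n.-tuple R) : set (n.-tuple R) :=
  [set x | forall k, tnth a k < tnth x k <= tnth b k].

Lemma measurable_box n (a b : n.-tuple R) : measurable (box a b).
Proof.
rewrite (_ : box a b = \bigcap_(k in [set: 'I_n]) ((fun x => tnth x k) @^-1` `]tnth a k, tnth b k]%classic)).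
  apply: fin_bigcap_measurable => // k _.
  by rewrite -[X in measurable X]setTI; apply: measurable_tnth.
by apply/seteqP; split => x /= h k; [move=> _|]; have := h k; rewrite /= in_itv/=;
  [|apply].
Qed.

Definition boxes n := [set A | exists a b : n.-tuple R, A = box a b].

Lemma boxes_generate n : @measurable _ (n.-tuple R) = <<s @boxes n >>.
Proof.
apply/seteqP; split; last first.
  apply: smallest_sub; first exact: sigma_algebra_measurable.
  by move=> _ [a [b ->]]; exact: measurable_box.
(* The remaining inclusion says that the identity is measurable from the sigma-algebra generated by
   boxes, which can be tested on coordinates and on open rays. *)
have : measurable_fun [set: g_sigma_algebraType (@boxes n)] (idfun : g_sigma_algebraType (@boxes n) -> n.-tuple R).
  apply/measurable_fun_tnthP => i.
  apply: (measurability _ (RGenOInfty.measurableE R)) => _ [_ [x ->] <-].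
  rewrite setTI.
  (* Coordinate i ranges over ]x, N] and the others over ]-N, N]; as N grows these boxes exhaust the
     preimage of the ray ]x, +oo[. *)
  pose a (N : nat) : n.-tuple R := [tuple (if k == i then x else - N%:R) | k < n].
  pose b (N : nat) : n.-tuple R := [tuple N%:R | k < n].
  rewrite (_ : _ @^-1` _ = \bigcup_N box (a N) (b N)).
    by apply: bigcup_measurable => N _; apply: sub_sigma_algebra; exists (a N), (b N).
  apply/seteqP; split => [y /= | y [N _ /(_ i)]] /=.
    rewrite in_itv/= andbT => xy.
    have [N hN] : exists N : nat, forall k, `|tnth y k| < N%:R.
      exists (Num.truncn (\sum_k `|tnth y k|)).+1 => k.
      apply: le_lt_trans (truncnS_gt _).
      by rewrite (bigD1 k)//= lerDl sumr_ge0.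
    exists N => // k; rewrite !tnth_mktuple.
    have := hN k; rewrite ltr_norml => /andP[h1 h2]; rewrite (ltW h2) andbT.
    by case: eqP => [->|].
  by rewrite !tnth_mktuple eqxx in_itv/= andbT => /andP[].
by move=> h A mA; have := h measurableT A mA; rewrite setTI.
Qed.

(** Boxes generate the sigma-algebra and are stable under intersection, and the cubes ]-N, N]^n
    exhaust the space with finite measure. *)
Lemma measure_unique_box n (m1 m2 : {measure set (n.-tuple R) -> \bar R}) :
  (forall a b : n.-tuple R, m1 (box a b) = m2 (box a b)) ->
  (forall a b : n.-tuple R, (m1 (box a b) < +oo)%E) ->
  forall A, measurable A -> m1 A = m2 A.
Proof.
move=> m12 m1oo.
apply: (measure_unique (@boxes n)
  (fun N => box [tuple - N%:R | k < n] [tuple N%:R | k < n])).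
- exact: boxes_generate.
- move=> _ _ [a [b ->]] [a' [b' ->]].
  (* If the two boxes are disjoint these corners cross in some coordinate, and [box] is then the
     empty set, so no separate case arises. *)
  exists [tuple Num.max (tnth a k) (tnth a' k) | k < n].
  exists [tuple Num.min (tnth b k) (tnth b' k) | k < n].
  apply/seteqP; split => [x [/= h1 h2] k|x /= h].
    by rewrite !tnth_mktuple gt_max le_min;
      move: (h1 k) (h2 k) => /andP[-> ->] /andP[-> ->].
  split => k; have := h k; rewrite !tnth_mktuple gt_max le_min => /andP[/andP[? ?] /andP[? ?]]; exact/andP.
- by move=> N; eexists; eexists; reflexivity.
- apply/seteqP; split => // y _.
  exists (Num.truncn (\sum_k `|tnth y k|)).+1 => // k; rewrite !tnth_mktuple.
  suff : `|tnth y k| < (Num.truncn (\sum_k `|tnth y k|)).+1%:R.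
    by rewrite ltr_norml => /andP[-> /ltW].
  apply: le_lt_trans (truncnS_gt _).
  by rewrite (bigD1 k)//= lerDl sumr_ge0.
- by move=> _ [a [b ->]].
- by [].
Qed.

End tuples.

(** * Fourier inversion for finite measures *)

Lemma patch_EFin (R : realType) T (g : T -> R) (A : set T) (x : T) :
  ((fun x => (g x)%:E) \_ A) x = (\1_A x * g x)%:E.
Proof. by rewrite patchE indicE; case: ifP; rewrite (mul1r, mul0r). Qed.

(** * Domination and change of measure by a density *)

Section integration.
Context {R : realType} {dd : measure_display} {T : measurableType dd}.

Lemma integrableM_bounded (mu : {measure set T -> \bar R}) (c g : T -> R) :
  mu.-integrable setT (EFin \o c) -> measurable_fun setT g ->
  (forall x, `|g x| <= 1) -> mu.-integrable setT (fun x => (c x * g x)%:E).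
Proof.
move=> ic mg g1.
have mc : measurable_fun setT c by apply/measurable_EFinP; case/integrableP : ic.
apply: le_integrable ic => //.
  by apply/measurable_EFinP; exact: measurable_funM.
by move=> x _; rewrite !abse_EFin lee_fin normrM ler_piMr.
Qed.

Lemma integral_lincomb (mu : {measure set T -> \bar R}) (f g : T -> R) (a b : R) :
  mu.-integrable setT (EFin \o f) -> mu.-integrable setT (EFin \o g) ->
  mu.-integrable setT (fun x => (a * f x + b * g x)%:E) /\
  (\int[mu]_x (a * f x + b * g x)%:E =
   (a * fine (\int[mu]_x (f x)%:E) + b * fine (\int[mu]_x (g x)%:E))%:E)%E.
Proof.
move=> jf jg.
have E : (fun x => (a * f x + b * g x)%:E) =
    (fun x => a%:E * (EFin \o f) x + b%:E * (EFin \o g) x)%E by [].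
have h1 := integrableZl measurableT a jf.
have h2 := integrableZl measurableT b jg.
split; first by rewrite E; exact: integrableD.
rewrite E integralD// !integralZl//= EFinD !EFinM !fineK//; exact: integrable_fin_num.
Qed.

Lemma cvg_integral_dominated (mu : {measure set T -> \bar R}) (f_ : nat -> T -> R) (f g : T -> R) :
  (forall n, measurable_fun setT (f_ n)) ->
  (forall x, f_ n x @[n --> \oo] --> f x) ->
  mu.-integrable setT (EFin \o g) -> (forall n x, `|f_ n x| <= g x) ->
  (\int[mu]_x (f_ n x)%:E)%E @[n --> \oo] --> (\int[mu]_x (f x)%:E)%E.
Proof.
move=> mf_ cf ig fg.
have mf : measurable_fun setT f by apply: (measurable_fun_cvg mf_) => x _; exact: cf.
have [] := @dominated_convergence _ _ _ mu setT measurableT (fun n => EFin \o f_ n) (EFin \o f) (EFin \o g) => //.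
- by move=> n; exact/measurable_EFinP.
- exact/measurable_EFinP.
- by apply: aeW => x _; apply: cvg_EFin; [exact: nearW|exact: cf].
- by apply: aeW => x n _; rewrite /= lee_fin.
Qed.

(* By the layer-cake formula for F and Tonelli it is enough to compare nu and mu
   on the sets [set x | t < F x]. *)
Lemma ge0_integral_density (nu mu : {sigma_finite_measure set T -> \bar R}) (p F : T -> R) :
  measurable_fun setT p -> (forall x, 0 <= p x) ->
  (forall A, measurable A -> nu A = \int[mu]_(x in A) (p x)%:E)%E ->
  measurable_fun setT F -> (forall x, 0 <= F x) ->
  (\int[nu]_x (F x)%:E = \int[mu]_x (F x * p x)%:E)%E.
Proof.
move=> mp p0 nuE mF F0.
pose D := [set z : T * measurableTypeR R | 0 <= z.2 < F z.1].
have mD : measurable D.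
  have m2 : measurable_fun setT (fun z : T * measurableTypeR R => z.2 : R).
    by have := @measurable_snd _ _ T (measurableTypeR R).
  have mF1 : measurable_fun setT (fun z : T * measurableTypeR R => F z.1).
    exact: measurableT_comp.
  rewrite (_ : D = [set z | 0 <= z.2] `&` [set z | z.2 < F z.1]).
    apply: measurableI.
    - by rewrite -[X in measurable X]setTI; apply: measurable_fun_le => //;
        exact: measurable_cst.
    - rewrite -[X in measurable X]setTI.
      exact: (measurable_fun_ltr m2 mF1 measurableT (Y := [set true])).
  by apply/seteqP; split => z /=; [move/andP|move=> ?; exact/andP].
have IF (x : T) : (\int[@lebesgue_measure R]_t (\1_D (x, t))%:E = (F x)%:E)%E.
  transitivity (\int[@lebesgue_measure R]_t (\1_(`[0, F x[%classic : set R) t)%:E)%E.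
    by apply: eq_integral => t _; rewrite !indicE; congr (_%:R%:E); apply/idP/idP;
      rewrite !inE /D/= in_itv/=.
  rewrite integral_indic//=.
  rewrite setIT lebesgue_measure_itv/= lte_fin sube0.
  by have := F0 x; rewrite le_eqVlt => /predU1P[<-|->//]; rewrite ltxx.
have m1D : measurable_fun setT (fun z : T * measurableTypeR R => (\1_D z : R)%:E).
  by apply/measurable_EFinP; exact: measurable_indic.
have m1Dt t : measurable [set x | D (x, t)].
  rewrite (_ : [set x | _] = ysection D t); first exact: measurable_ysection.
  by apply/seteqP; split => x; rewrite /ysection/= inE.
transitivity (\int[nu]_x \int[@lebesgue_measure R]_t (\1_D (x, t))%:E)%E.
  by apply: eq_integral => x _; rewrite IF.
rewrite (fubini_tonelli (fun z : T * measurableTypeR R => (\1_D z : R)%:E))//.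
transitivity (\int[@lebesgue_measure R]_t \int[mu]_x (\1_D (x, t) * p x)%:E)%E.
  apply: eq_integral => t _.
  transitivity (nu [set x | D (x, t)]).
    by rewrite -[X in nu X]setIT -integral_indic.
  rewrite nuE// integral_mkcond; apply: eq_integral => x _.
  by rewrite patch_EFin !indicE.
rewrite -(fubini_tonelli (fun z : T * measurableTypeR R => (\1_D z * p z.1)%:E))//.
- apply: eq_integral => x _ /=.
  under eq_integral do rewrite EFinM muleC.
  have mx : measurable_fun setT (fun t : measurableTypeR R => (\1_D (x, t) : R)%:E).
    exact: (measurableT_comp m1D (measurable_pair1 x)).
  rewrite (ge0_integralZl _ measurableT mx) ?lee_fin//.
  by rewrite -[X in (_ * X)%E]/(\int[@lebesgue_measure R]_t (\1_D (x, t))%:E)%E IF -EFinM mulrC.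
- by apply/measurable_EFinP/measurable_funM;
    [exact: measurable_indic|exact: measurableT_comp].
- by move=> z; rewrite lee_fin mulr_ge0.
Qed.

(** Multiplication by p >= 0 commutes with taking positive and negative parts, so each part reduces
    to the nonnegative case. *)
Lemma integral_density (nu mu : {sigma_finite_measure set T -> \bar R}) (p F : T -> R) :
  measurable_fun setT p -> (forall x, 0 <= p x) ->
  (forall A, measurable A -> nu A = \int[mu]_(x in A) (p x)%:E)%E ->
  measurable_fun setT F ->
  (\int[nu]_x (F x)%:E = \int[mu]_x (F x * p x)%:E)%E.
Proof.
move=> mp p0 nuE mF.
rewrite integralE [RHS]integralE; congr (_ - _)%E.
- transitivity (\int[nu]_x (Num.max (F x) 0)%:E)%E.
    by apply: eq_integral => x _; rewrite funeposE EFin_max.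
  rewrite (ge0_integral_density mp p0 nuE)//.
  + by apply: eq_integral => x _; rewrite funeposE -EFin_max maxr_pMl// mul0r.
  + exact: measurable_maxr.
  + by move=> x; rewrite le_max lexx orbT.
- transitivity (\int[nu]_x (Num.max (- F x) 0)%:E)%E.
    by apply: eq_integral => x _; rewrite funenegE EFin_max.
  rewrite (ge0_integral_density mp p0 nuE)//.
  + by apply: eq_integral => x _; rewrite funenegE -EFinN -EFin_max maxr_pMl// mul0r mulNr.
  + by apply: measurable_maxr => //; exact: measurableT_comp.
  + by move=> x; rewrite le_max lexx orbT.
Qed.

(** The two proofs are arguments of the definition so that a measure structure can be attached to
    the resulting term. *)
Definition density_measure (mu : {measure set T -> \bar R}) (p : T -> R)
  of measurable_fun setT p & (forall x, 0 <= p x) : set T -> \bar R :=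
  fun A => (\int[mu]_(x in A) (p x)%:E)%E.

Section density_measure.
Variables (mu : {measure set T -> \bar R}) (p : T -> R).
Hypotheses (mp : measurable_fun setT p) (p0 : forall x, 0 <= p x).

Let density_measure0 : density_measure mu mp p0 set0 = 0%E.
Proof. exact: integral_set0. Qed.

Let density_measure_ge0 A : (0 <= density_measure mu mp p0 A)%E.
Proof. by apply: integral_ge0 => x _; rewrite lee_fin. Qed.

Let density_measure_sigma_additive : semi_sigma_additive (density_measure mu mp p0).
Proof.
apply: semi_sigma_additive_nng_induced; first exact/measurable_EFinP.
by move=> x; rewrite lee_fin.
Qed.

HB.instance Definition _ := isMeasure.Build _ _ _ (density_measure mu mp p0)
  density_measure0 density_measure_ge0 density_measure_sigma_additive.
End density_measure.

Lemma measurable_dotp2 n (f g : T -> n.-tuple R) :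
  measurable_fun setT f -> measurable_fun setT g ->
  measurable_fun setT (fun z => dotp (f z) (g z)).
Proof.
move=> mf mg; apply: measurable_sum => i; apply: measurable_funM.
- exact: (measurableT_comp (@measurable_tnth _ _ _ i) mf).
- exact: (measurableT_comp (@measurable_tnth _ _ _ i) mg).
Qed.

End integration.

Lemma dotp_subt (R : realType) n (u y x : n.-tuple R) :
  dotp u (subt y x) = dotp u y - dotp u x.
Proof.
rewrite /dotp -sumrB; apply: eq_bigr => k _.
by rewrite tnth_mktuple mulrBr.
Qed.

Lemma dotpC (R : realType) n (u y : n.-tuple R) : dotp u y = dotp y u.
Proof. by apply: eq_bigr => k _; rewrite mulrC. Qed.

Lemma measurable_cos (R : realType) : measurable_fun [set: R] (@cos R).
Proof. exact: continuous_measurable_fun (@continuous_cos R). Qed.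

Lemma measurable_sin (R : realType) : measurable_fun [set: R] (@sin R).
Proof. exact: continuous_measurable_fun (@continuous_sin R). Qed.

Lemma cvg_prodr (R : realType) (I : Type) (r : seq I) (f : I -> nat -> R) (l : I -> R) :
  (forall i, f i n @[n --> \oo] --> l i) ->
  \prod_(i <- r) f i n @[n --> \oo] --> \prod_(i <- r) l i.
Proof.
move=> fl; elim: r => [|i r IH].
  by under eq_cvg do rewrite big_nil; rewrite big_nil; exact: cvg_cst.
under eq_cvg do rewrite big_cons.
by rewrite big_cons; apply: cvgM.
Qed.

Lemma indic_box (R : realType) d (a b x : d.-tuple R) :
  \1_(box a b) x = \prod_(k < d) \1_(`]tnth a k, tnth b k]%classic : set R) (tnth x k) :> R.
Proof.
have [/forallP h|/forallPn[k hk]] := boolP [forall k, tnth a k < tnth x k <= tnth b k].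
  rewrite indicE mem_set//= big1// => k _.
  by rewrite indicE mem_set//= in_itv/=.
rewrite indicE memNset//=; last by move=> h; move/negP: hk; apply; exact: h.
rewrite (bigD1 k)//= indicE memNset ?mul0r//= in_itv/=.
exact/negP.
Qed.

(** The sequence is eventually constant. A shift to the right agrees with the half-open convention:
    x = a stays outside every shifted interval, and x = b is inside as soon as the left end has
    passed below it. *)
Lemma cvg_indic_shift (R : realType) (a b x : R) :
  \1_(`]a + n.+1%:R^-1, b + n.+1%:R^-1]%classic : set R) x @[n --> \oo] -->
  (\1_(`]a, b]%classic : set R) x : R).
Proof.
have near_lt (c : R) : c < x -> \forall n \near \oo, c + n.+1%:R^-1 < x.
  move=> cx; have h : 0 < x - c by rewrite subr_gt0.
  have := near_infty_natSinv_lt (PosNum h); apply: filterS => n /=.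
  by rewrite ltrBrDl.
apply: cvg_near_cst.
have [xa|ax] := leP x a.
  apply: nearW => n; rewrite !indicE !memNset//= in_itv/= ltNge ?xa//.
  by rewrite (le_trans xa)// lerDl.
have [xb|bx] := leP x b.
  near=> n; rewrite !indicE !mem_set//= in_itv/= ?ax ?xb//.
  rewrite (le_trans xb) ?lerDl// andbT.
  by near: n; exact: near_lt.
near=> n.
have bnx : b + n.+1%:R^-1 < x by near: n; exact: near_lt.
by rewrite !indicE !memNset//= in_itv/= => /andP[_]; rewrite leNgt ?bx ?bnx.
Unshelve. all: by end_near. Qed.

Lemma integral_itv_cauchy (R : realType) (e a b y : R) : 0 < e -> a < b ->
  (@lebesgue_measure R).-integrable setT
    (EFin \o (fun x => \1_(`]a, b]%classic : set R) x * (2 * e / (e ^+ 2 + (y - x) ^+ 2)))) /\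
  (\int[@lebesgue_measure R]_x
    (\1_(`]a, b]%classic : set R) x * (2 * e / (e ^+ 2 + (y - x) ^+ 2)))%:E =
   (2 * (atan ((b - y) / e) - atan ((a - y) / e)))%:E)%E.
Proof.
move=> e0 ab; set f := fun x : R => _ * _.
have If : (\int[@lebesgue_measure R]_x (f x)%:E =
   (2 * (atan ((b - y) / e) - atan ((a - y) / e)))%:E)%E.
  rewrite -integral_cauchy// [RHS]integral_mkcond; apply: eq_integral => x _.
  by rewrite patch_EFin.
have f0 x : 0 <= f x.
  by rewrite mulr_ge0// divr_ge0 ?mulr_ge0 ?(ltW e0) ?(ltW (sqrD_gt0 _ _)).
split => //; apply/integrableP; split; last first.
  under eq_integral do rewrite /= ger0_norm//.
  by rewrite If ltry.
apply/measurable_EFinP/measurable_funM.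
  by apply: measurable_indic; exact: measurable_itv.
apply: (@measurableT_comp _ _ _ _ _ _ (fun t : R => 2 * e / (e ^+ 2 + t ^+ 2))).
  by apply: continuous_measurable_fun; exact: continuous_cauchy.
by apply: measurable_funB => //; exact: measurable_cst.
Qed.

Lemma integrable_indic_box (R : realType) d (a b : d.-tuple R) :
  (leb R d).-integrable setT (fun x => (\1_(box a b) x)%:E).
Proof.
have ji k : (@lebesgue_measure R).-integrable setT
    (EFin \o (\1_(`]tnth a k, tnth b k]%classic : set R))).
  apply/integrableP; split.
    by apply/measurable_EFinP/measurable_indic; exact: measurable_itv.
  under eq_integral do rewrite /= ger0_norm//.
  rewrite integral_indic//=.
  by rewrite setIT lebesgue_measure_itv/=; case: ifP => // _; rewrite -EFinB ltry.
have [h _] := integral_leb_prod ji (fun k => esym (fineK (integrable_fin_num measurableT (ji k)))).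
by apply: eq_integrable h => // x _; rewrite indic_box.
Qed.

Definition addt (R : realType) d (a : d.-tuple R) (h : R) : d.-tuple R :=
  [tuple tnth a k + h | k < d].

(** * The regularized inverse transform and its limit *)

Section inversion.
Context {R : realType} {d : nat} (m : {finite_measure set (d.-tuple R) -> \bar R}).
Local Notation lam := (leb R d).
Implicit Types (u x y a b : d.-tuple R) (e : R).

Definition cos_transform u : R := fine (\int[m]_y (cos (dotp u y))%:E)%E.
Definition sin_transform u : R := fine (\int[m]_y (sin (dotp u y))%:E)%E.

Local Notation c := cos_transform.
Local Notation s := sin_transform.

(* Real and imaginary parts of e^(-i<u, x>) times the Fourier transform of m at u. *)
Definition re_twist x u : R := c u * cos (dotp u x) + s u * sin (dotp u x).
Definition im_twist x u : R := s u * cos (dotp u x) - c u * sin (dotp u x).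

(** Left unnormalized: its total mass in x is (2 pi)^d, which [inv_density] divides out. *)
Definition cauchy_kernel e x y : R :=
  \prod_(k < d) (2 * e / (e ^+ 2 + (tnth y k - tnth x k) ^+ 2)).

Lemma measurable_cosd u : measurable_fun setT (fun y => cos (dotp u y)).
Proof. by apply: measurableT_comp; [exact: measurable_cos|exact: measurable_dotp]. Qed.

Lemma measurable_sind u : measurable_fun setT (fun y => sin (dotp u y)).
Proof. by apply: measurableT_comp; [exact: measurable_sin|exact: measurable_dotp]. Qed.

Lemma integrable_cst1 : m.-integrable setT (fun=> 1%:E).
Proof. exact: finite_measure_integrable_cst. Qed.

Lemma integrable_trig (g : d.-tuple R -> R) : measurable_fun setT g -> (forall x, `|g x| <= 1) ->
  m.-integrable setT (EFin \o g).
Proof.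
move=> mg g1; have := integrableM_bounded integrable_cst1 mg g1.
by apply: eq_integrable => // x _ /=; rewrite mul1r.
Qed.

Lemma laplace_kernel_integrable e : 0 < e ->
  lam.-integrable setT (fun u => (laplace_kernel e u)%:E).
Proof.
move=> e0; have [h _ _ _] := integral_laplace_kernel (vec0 R d) e0.
apply: eq_integrable h => // u _ /=; rewrite /dotp big1 ?cos0 ?mulr1// => k _.
by rewrite tnth_mktuple mulr0.
Qed.

Lemma measurable_laplace_kernel e : measurable_fun [set: d.-tuple R] (laplace_kernel e).
Proof.
apply: measurableT_comp => //; apply: measurable_funM; first exact: measurable_cst.
by apply: measurable_sum => k; apply: measurableT_comp => //; exact: measurable_tnth.
Qed.

(** Here the damping pays: the Laplace kernel is integrable in the first variable and [m] is finite
    in the second, so Fubini applies, whereas the bare trigonometric factor has no decay in u. *)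
Lemma integrable_kernel_trig e (g : R -> R) x : 0 < e -> measurable_fun setT g ->
  (forall t, `|g t| <= 1) ->
  (lam \x m)%E.-integrable setT
    (fun z => (laplace_kernel e z.1 * g (dotp z.1 (subt z.2 x)))%:E).
Proof.
move=> e0 mg g1.
have [h _] := integral_tensor (laplace_kernel_integrable e0) integrable_cst1.
have mlk : measurable_fun setT (fun z : d.-tuple R * d.-tuple R => laplace_kernel e z.1).
  by apply: (measurableT_comp (@measurable_laplace_kernel e)); exact: measurable_fst.
apply: le_integrable h => //.
- apply/measurable_EFinP/measurable_funM => //.
  apply: (measurableT_comp mg); apply: measurable_dotp2 => //.
  exact: (measurableT_comp (@measurable_subt R d x)).
- move=> z _; rewrite !abse_EFin lee_fin mulr1 normrM ler_piMr//.
Qed.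

Lemma integral_kernel_Re e x u :
  (\int[m]_y (laplace_kernel e u * cos (dotp u (subt y x)))%:E =
   (laplace_kernel e u * re_twist x u)%:E)%E.
Proof.
have [_ h] := integral_lincomb (laplace_kernel e u * cos (dotp u x)) (laplace_kernel e u * sin (dotp u x))
  (integrable_trig (measurable_cosd u) (fun=> cos_max _)) (integrable_trig (measurable_sind u) (fun=> sin_max _)).
transitivity ((laplace_kernel e u * cos (dotp u x) * c u + laplace_kernel e u * sin (dotp u x) * s u)%:E).
  rewrite -h; apply: eq_integral => y _; rewrite dotp_subt cosB; congr EFin; ring.
by rewrite /re_twist; congr EFin; ring.
Qed.

Lemma integral_kernel_Im e x u :
  (\int[m]_y (laplace_kernel e u * sin (dotp u (subt y x)))%:E =
   (laplace_kernel e u * im_twist x u)%:E)%E.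
Proof.
have [_ h] := integral_lincomb (- laplace_kernel e u * sin (dotp u x)) (laplace_kernel e u * cos (dotp u x))
  (integrable_trig (measurable_cosd u) (fun=> cos_max _)) (integrable_trig (measurable_sind u) (fun=> sin_max _)).
transitivity ((- laplace_kernel e u * sin (dotp u x) * c u + laplace_kernel e u * cos (dotp u x) * s u)%:E).
  rewrite -h; apply: eq_integral => y _; rewrite dotp_subt sinB; congr EFin; ring.
by rewrite /im_twist; congr EFin; ring.
Qed.

(** Integrating first over y gives the transform of [m], integrating first over u gives the Cauchy
    kernel at y - x. *)
Lemma regularized_Re e x : 0 < e ->
  (\int[lam]_u (laplace_kernel e u * re_twist x u)%:E =
   \int[m]_y (cauchy_kernel e x y)%:E)%E.
Proof.
move=> e0; under eq_integral do rewrite -integral_kernel_Re.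
rewrite (Fubini (integrable_kernel_trig x e0 (@measurable_cos R) (@cos_max R)))/=.
apply: eq_integral => y _; have [_ _ -> _] := integral_laplace_kernel (subt y x) e0.
by congr EFin; apply: eq_bigr => k _; rewrite tnth_mktuple.
Qed.

Lemma regularized_Im e x : 0 < e ->
  (\int[lam]_u (laplace_kernel e u * im_twist x u)%:E = 0)%E.
Proof.
move=> e0; under eq_integral do rewrite -integral_kernel_Im.
rewrite (Fubini (integrable_kernel_trig x e0 (@measurable_sin R) (@sin_max R)))/=.
apply: integral0_eq => y _; by have [_ _ _ ->] := integral_laplace_kernel (subt y x) e0.
Qed.

Hypothesis jc : lam.-integrable setT (EFin \o c).
Hypothesis js : lam.-integrable setT (EFin \o s).

Lemma integrable_re_twist x : lam.-integrable setT (EFin \o re_twist x).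
Proof.
have h1 : lam.-integrable setT (fun u => (c u * cos (dotp u x))%:E).
  apply: integrableM_bounded => // [|u]; last exact: cos_max.
  by under eq_fun do rewrite dotpC; exact: measurable_cosd.
have h2 : lam.-integrable setT (fun u => (s u * sin (dotp u x))%:E).
  apply: integrableM_bounded => // [|u]; last exact: sin_max.
  by under eq_fun do rewrite dotpC; exact: measurable_sind.
exact: integrableD h1 h2.
Qed.

Lemma integrable_im_twist x : lam.-integrable setT (EFin \o im_twist x).
Proof.
have h1 : lam.-integrable setT (fun u => (s u * cos (dotp u x))%:E).
  apply: integrableM_bounded => // [|u]; last exact: cos_max.
  by under eq_fun do rewrite dotpC; exact: measurable_cosd.
have h2 : lam.-integrable setT (fun u => (c u * sin (dotp u x))%:E).
  apply: integrableM_bounded => // [|u]; last exact: sin_max.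
  by under eq_fun do rewrite dotpC; exact: measurable_sind.
exact: integrableB h1 h2.
Qed.

(** Dominated convergence with bound |h|. The rate (n + 1)^-2 is the one that [cvg_atan_step] will
    require. *)
Lemma cvg_laplace_kernel (h : d.-tuple R -> R) : lam.-integrable setT (EFin \o h) ->
  (\int[lam]_u (laplace_kernel (n.+1%:R ^- 2) u * h u)%:E)%E @[n --> \oo] -->
  (\int[lam]_u (h u)%:E)%E.
Proof.
move=> ih; have mh : measurable_fun setT h by apply/measurable_EFinP;
  case/integrableP : ih.
apply: (@cvg_integral_dominated _ _ _ _ _ _ (fun u => `|h u|)).
- by move=> n; apply: measurable_funM => //; exact: measurable_laplace_kernel.
- move=> u; rewrite -[X in _ --> X]mul1r; apply: cvgM; last exact: cvg_cst.
  have h0 : - n.+1%:R ^- 2 * \sum_(k < d) `|tnth u k| @[n --> \oo] --> (0 : R).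
    rewrite -[X in _ --> X](mul0r (\sum_(k < d) `|tnth u k|)); apply: cvgM;
      last exact: cvg_cst.
    rewrite -[X in _ --> X]oppr0; apply: cvgN.
    rewrite -[X in _ --> X](mulr0 0).
    under eq_cvg do rewrite expr2 invfM.
    by apply: cvgM; exact: cvg_harmonic.
  rewrite -[X in _ --> X](@expR0 R) /laplace_kernel.
  exact: (cvg_comp _ _ h0 (@continuous_expR R 0)).
- exact: integrable_abse ih.
- move=> n u; rewrite normrM ler_piMl//.
  by rewrite ger0_norm ?laplace_kernel_ge0// laplace_kernel_le1.
Qed.

Definition inv_fourier x : R := fine (\int[lam]_u (re_twist x u)%:E)%E.

Lemma inv_fourierE x : (\int[lam]_u (re_twist x u)%:E = (inv_fourier x)%:E)%E.
Proof. by rewrite fineK//; apply: integrable_fin_num => //; exact: integrable_re_twist. Qed.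

(** The regularized inverse transform, written on the Cauchy side of [regularized_Re] so that it is
    visibly nonnegative. *)
Let Pn (n : nat) x : R := fine (\int[m]_y (cauchy_kernel (n.+1%:R ^- 2) x y)%:E)%E.

Let PnE n x : ((Pn n x)%:E = \int[m]_y (cauchy_kernel (n.+1%:R ^- 2) x y)%:E)%E.
Proof.
rewrite /Pn -regularized_Re ?invr_gt0 ?exprn_gt0//= fineK//.
apply: integrable_fin_num => //.
have := integrableM_bounded (integrable_re_twist x) (@measurable_laplace_kernel (n.+1%:R ^- 2)).
move=> h; apply: eq_integrable (h _) => // [u _|u].
  by rewrite /= mulrC.
by rewrite ger0_norm ?laplace_kernel_ge0// laplace_kernel_le1.
Qed.

Lemma cauchy_kernel_ge0 e x y : 0 < e -> 0 <= cauchy_kernel e x y.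
Proof.
move=> e0; apply: prodr_ge0 => k _; rewrite divr_ge0 ?mulr_ge0 ?(ltW e0)//.
by rewrite ltW// sqrD_gt0.
Qed.

Let e_gt0 n : 0 < (n.+1%:R ^- 2) :> R.
Proof. by rewrite invr_gt0 exprn_gt0. Qed.

Let Pn_ge0 n x : 0 <= Pn n x.
Proof. by apply: fine_ge0; apply: integral_ge0 => y _; rewrite lee_fin cauchy_kernel_ge0. Qed.

Let Pn_cvg x : Pn n x @[n --> \oo] --> inv_fourier x.
Proof.
have := cvg_laplace_kernel (integrable_re_twist x).
under eq_cvg => n do rewrite regularized_Re// -PnE.
rewrite inv_fourierE.
by move/fine_cvgP => [_].
Qed.

(** A limit of integrals that are all zero by [regularized_Im]; hence the inverse transform is real
    and [inv_fourier] keeps all of it. *)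
Lemma integral_im_twist x : (\int[lam]_u (im_twist x u)%:E = 0)%E.
Proof.
have := cvg_laplace_kernel (integrable_im_twist x).
under eq_cvg => n do rewrite regularized_Im//.
by move/cvg_lim => <-//; rewrite lim_cst.
Qed.

Lemma inv_fourier_ge0 x : 0 <= inv_fourier x.
Proof.
rewrite -(cvg_lim _ (@Pn_cvg x))//.
by apply: limr_ge; [apply/cvg_ex; eexists; exact: (@Pn_cvg x)|exact: nearW].
Qed.


Definition atan_box e a b y : R := \prod_(k < d)
  (2 * (atan ((tnth b k - tnth y k) / e) - atan ((tnth a k - tnth y k) / e))).

Lemma integral_box_cauchy e a b y : 0 < e -> (forall k, tnth a k < tnth b k) ->
  (\int[lam]_x (\1_(box a b) x * cauchy_kernel e x y)%:E = (atan_box e a b y)%:E)%E.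
Proof.
move=> e0 ab.
have [_ <-] := integral_leb_prod
  (fun k => (integral_itv_cauchy (tnth y k) e0 (ab k)).1)
  (fun k => (integral_itv_cauchy (tnth y k) e0 (ab k)).2).
by apply: eq_integral => x _; rewrite indic_box -big_split.
Qed.

Let mcauchy e : 0 < e ->
  measurable_fun setT (fun z : d.-tuple R * d.-tuple R => cauchy_kernel e z.1 z.2).
Proof.
move=> e0; apply: measurable_prod => k _.
apply: (@measurableT_comp _ _ _ _ _ _ (fun t : R => 2 * e / (e ^+ 2 + t ^+ 2))).
  by apply: continuous_measurable_fun; exact: continuous_cauchy.
apply: measurable_funB.
- exact: (measurableT_comp (@measurable_tnth _ _ _ k) measurable_snd).
- exact: (measurableT_comp (@measurable_tnth _ _ _ k) measurable_fst).
Qed.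

Let mPn n : measurable_fun setT (Pn n).
Proof.
apply/measurable_EFinP.
rewrite (_ : _ \o _ = fun x => \int[m]_y (cauchy_kernel (n.+1%:R ^- 2) x y)%:E)%E;
  last first.
  by apply/funext => x /=; rewrite PnE.
apply: (measurable_fun_fubini_tonelli_F (fun z : d.-tuple R * d.-tuple R => (cauchy_kernel (n.+1%:R ^- 2) z.1 z.2)%:E)).
- by apply/measurable_EFinP; exact: mcauchy.
- by move=> z; rewrite lee_fin cauchy_kernel_ge0.
Qed.

Lemma measurable_inv_fourier : measurable_fun setT inv_fourier.
Proof. by apply: (measurable_fun_cvg mPn) => x _; exact: (@Pn_cvg x). Qed.

Lemma integral_box_regularized n a b : (forall k, tnth a k < tnth b k) ->
  (\int[lam]_x (\1_(box a b) x * Pn n x)%:E =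
   \int[m]_y (atan_box (n.+1%:R ^- 2) a b y)%:E)%E.
Proof.
move=> ab.
transitivity (\int[lam]_x \int[m]_y (\1_(box a b) x * cauchy_kernel (n.+1%:R ^- 2) x y)%:E)%E.
  apply: eq_integral => x _; rewrite EFinM PnE -ge0_integralZl//.
  - apply/measurable_EFinP.
    exact: (measurableT_comp (mcauchy (e_gt0 n)) (measurable_pair1 x)).
  - by move=> y _; rewrite lee_fin cauchy_kernel_ge0.
rewrite (fubini_tonelli (fun z : d.-tuple R * d.-tuple R => (\1_(box a b) z.1 * cauchy_kernel (n.+1%:R ^- 2) z.1 z.2)%:E)).
- by apply: eq_integral => y _; rewrite integral_box_cauchy.
- apply/measurable_EFinP/measurable_funM; last exact: mcauchy.
  by apply: (measurableT_comp _ measurable_fst); apply: measurable_indic;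
    exact: measurable_box.
- by move=> z; rewrite lee_fin mulr_ge0// cauchy_kernel_ge0.
Qed.

Let C : R := fine (\int[lam]_u (`|c u| + `|s u|)%:E)%E.

(** The bound is uniform in both n and x, which yields a dominating function on any bounded box. It
    comes from the Fourier side, where the modulus of [re_twist] is at most |c| + |s|. *)
Let Pn_le n x : Pn n x <= C.
Proof.
have iCs : lam.-integrable setT (fun u => (`|c u| + `|s u|)%:E).
  exact: integrableD (integrable_abse jc) (integrable_abse js).
have mRe : measurable_fun setT (re_twist x).
  by apply/measurable_EFinP; case/integrableP : (integrable_re_twist x).
rewrite -lee_fin PnE -regularized_Re// /C fineK; last exact: integrable_fin_num.
have mf : measurable_fun setT (fun u => laplace_kernel (n.+1%:R ^- 2) u * re_twist x u).
  by apply: measurable_funM => //; exact: measurable_laplace_kernel.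
apply: le_trans (lee_abs _) _; apply: le_trans (le_abse_integral _ _ _) _ => //.
  exact/measurable_EFinP.
apply: ge0_le_integral => //.
- by apply/measurable_EFinP; exact: measurableT_comp.
- by case/integrableP : iCs.
- move=> u _; rewrite abse_EFin lee_fin normrM.
  apply: (@le_trans _ _ (1 * `|re_twist x u|)).
    rewrite ler_wpM2r//.
    by rewrite ger0_norm ?laplace_kernel_ge0// laplace_kernel_le1.
  rewrite mul1r (le_trans (ler_normD _ _))// !normrM lerD// ler_piMr//.
  + exact: cos_max.
  + exact: sin_max.
Qed.

(* The box moves by 1/n while the scale of the kernel is 1/n^2, so that a face of
   the limit box is approached from inside or from outside as its half-open type
   requires, instead of getting weight 1/2. *)
Lemma cvg_integral_box_density a b :
  (\int[lam]_x (\1_(box (addt a n.+1%:R^-1) (addt b n.+1%:R^-1)) x * Pn n x)%:E)%E @[n --> \oo] -->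
  (\int[lam]_x (\1_(box a b) x * inv_fourier x)%:E)%E.
Proof.
(* As 0 < 1/(n + 1) <= 1, every shifted box lies in the box from a to b + 1. *)
apply: (@cvg_integral_dominated _ _ _ _ _ _ (fun x => C * \1_(box a (addt b 1)) x)).
- by move=> n; apply: measurable_funM => //; apply: measurable_indic;
    exact: measurable_box.
- move=> x; apply: cvgM; last exact: (@Pn_cvg x).
  under eq_cvg do rewrite indic_box.
  rewrite indic_box; apply: cvg_prodr => k.
  under eq_cvg do rewrite !tnth_mktuple.
  exact: cvg_indic_shift.
- exact: (integrableZl measurableT C (integrable_indic_box a (addt b 1))).
- move=> n x; rewrite ger0_norm ?mulr_ge0// mulrC ler_pM//.
  rewrite !indicE ler_nat.
  have [|//] := boolP (x \in box (addt a n.+1%:R^-1) (addt b n.+1%:R^-1)).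
  rewrite inE => h; rewrite mem_set// => k; have := h k.
  rewrite !tnth_mktuple => /andP[h1 h2]; apply/andP; split.
    by rewrite (lt_trans _ h1)// ltrDl.
  by rewrite (le_trans h2)// lerD2l invf_le1// ler1n.
Qed.

(** By [cvg_atan_step] each factor tends to 2 pi inside ]a_k, b_k] and to 0 outside, where the two
    step limits cancel. Arctangents lie strictly between -pi/2 and pi/2, so the product is at most
    (2 pi)^d in modulus, a constant that the finite measure [m] integrates. *)
Lemma cvg_integral_atan_box a b : (forall k, tnth a k < tnth b k) ->
  (\int[m]_y (atan_box (n.+1%:R ^- 2) (addt a n.+1%:R^-1) (addt b n.+1%:R^-1) y)%:E)%E @[n --> \oo] -->
  (((2 * pi) ^+ d)%:E * m (box a b))%E.
Proof.
move=> ab.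
have -> : (((2 * pi) ^+ d)%:E * m (box a b) = \int[m]_y ((2 * pi) ^+ d * \1_(box a b) y)%:E)%E.
  under eq_integral do rewrite EFinM.
  rewrite ge0_integralZl//.
  - by rewrite integral_indic ?setIT//; exact: measurable_box.
  - by apply/measurable_EFinP/measurable_indic; exact: measurable_box.
  - by rewrite lee_fin exprn_ge0// mulr_ge0// pi_ge0.
apply: (@cvg_integral_dominated _ _ _ _ _ _ (cst ((2 * pi) ^+ d))).
- move=> n; apply: measurable_prod => k _; apply: measurable_funM => //.
  have matan (z : R) : measurable_fun setT (fun y : d.-tuple R => atan ((z - tnth y k) / n.+1%:R ^- 2)).
    apply: (@measurableT_comp _ _ _ _ _ _ (@atan R)).
      by apply: continuous_measurable_fun; exact: continuous_atan.
    apply: measurable_funM => //; apply: measurable_funB => //; exact: measurable_tnth.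
  exact: measurable_funB.
- move=> y; rewrite indic_box.
  have -> : (2 * pi) ^+ d = \prod_(k < d) (2 * pi) :> R by rewrite prodr_const card_ord.
  rewrite -big_split/= /atan_box; apply: cvg_prodr => k.
  under eq_cvg do rewrite !tnth_mktuple.
  have -> : 2 * pi * \1_(`]tnth a k, tnth b k]%classic : set R) (tnth y k) =
    2 * ((if tnth y k <= tnth b k then pi / 2 else - (pi / 2)) -
         (if tnth y k <= tnth a k then pi / 2 else - (pi / 2))) :> R.
    rewrite indicE; have [ya|ay] := leP (tnth y k) (tnth a k).
      rewrite (le_trans ya (ltW (ab k))) memNset/=; first by ring.
      by rewrite in_itv/= ltNge ya.
    have [yb|by_] := leP (tnth y k) (tnth b k).
      by rewrite mem_set/= ?in_itv/= ?ay ?yb//; field.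
    by rewrite memNset/= ?in_itv/= ?ay ?leNgt ?by_//; ring.
  apply: cvgM; first exact: cvg_cst.
  by apply: cvgB; exact: cvg_atan_step.
- exact: finite_measure_integrable_cst.
- move=> n y; rewrite normr_prod.
  have -> : (2 * pi) ^+ d = \prod_(k < d) (2 * pi) :> R by rewrite prodr_const card_ord.
  apply: ler_prod => k _; rewrite normr_ge0/= normrM ger0_norm// ler_wpM2l//.
  set u := _ / _; set v := _ / _.
  have := atan_gtNpi2 u; have := atan_ltpi2 u; have := atan_gtNpi2 v;
    have := atan_ltpi2 v.
  by rewrite ler_norml => *; apply/andP; split; lra.
Qed.

Lemma integral_box_inv_fourier a b :
  (\int[lam]_x (\1_(box a b) x * inv_fourier x)%:E = ((2 * pi) ^+ d)%:E * m (box a b))%E.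
Proof.
have [/forallP ab|/forallPn[k]] := boolP [forall k, tnth a k < tnth b k].
  have h1 := @cvg_integral_box_density a b.
  have h2 := cvg_integral_atan_box ab.
  have ab' n k : tnth (addt a n.+1%:R^-1) k < tnth (addt b n.+1%:R^-1) k.
    by rewrite !tnth_mktuple ltrD2r.
  move: h1; under eq_cvg => n do rewrite (integral_box_regularized n (ab' n)).
  by move=> h1; exact: (cvg_unique _ h1 h2).
(* The arctangent computation assumes nondegenerate sides; a box with a degenerate side is empty and
   both members are zero. *)
rewrite -leNgt => ba.
have -> : box a b = set0.
  apply/seteqP; split => // x /(_ k)/andP[h1 h2].
  by have := lt_le_trans h1 (le_trans h2 ba); rewrite ltxx.
rewrite measure0 mule0; apply: integral0_eq => x _.
by rewrite indic0 mul0r.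
Qed.

Definition inv_density x : R := inv_fourier x / (2 * pi) ^+ d.

Let two_pi_gt0 : 0 < (2 * pi) ^+ d :> R.
Proof. by rewrite exprn_gt0// mulr_gt0// pi_gt0. Qed.

Lemma inv_density_ge0 x : 0 <= inv_density x.
Proof. by rewrite divr_ge0 ?inv_fourier_ge0// ltW. Qed.

Lemma measurable_inv_density : measurable_fun setT inv_density.
Proof. by apply: measurable_funM => //; exact: measurable_inv_fourier. Qed.

(** Both sides are measures in A that agree on boxes, where [m] is finite. In particular [m] is
    absolutely continuous. *)
Lemma fourier_inversion A : measurable A ->
  m A = (\int[lam]_(x in A) (inv_density x)%:E)%E.
Proof.
rewrite -[RHS]/(density_measure lam measurable_inv_density inv_density_ge0 A).
apply: measure_unique_box => a b; last first.
  by rewrite ltey_eq fin_num_measure//; exact: measurable_box.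
rewrite /= /density_measure integral_mkcond.
transitivity (((2 * pi) ^- d)%:E * \int[lam]_x (\1_(box a b) x * inv_fourier x)%:E)%E.
  by rewrite integral_box_inv_fourier muleA -EFinM mulVf ?mul1e// gt_eqF.
rewrite -ge0_integralZl//.
- apply: eq_integral => x _; rewrite patch_EFin -!EFinM /inv_density; congr EFin; ring.
- apply/measurable_EFinP/measurable_funM; last exact: measurable_inv_fourier.
  by apply: measurable_indic; exact: measurable_box.
- by move=> x _; rewrite lee_fin mulr_ge0 ?inv_fourier_ge0.
- by rewrite lee_fin invr_ge0 ltW.
Qed.

End inversion.

(** * The pricing formula *)

Section complex_values.
Context {R : realType}.

Lemma expC_imM (t : R) : expC (imC R * t%:C) = cos t +i* sin t.
Proof. by rewrite /expC /imC; simpc; rewrite expR0 !mul1r. Qed.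

Lemma sum_complex n (a b : 'I_n -> R) :
  \sum_k (a k +i* b k) = (\sum_k a k) +i* (\sum_k b k).
Proof.
elim: n a b => [a b|n IH a b]; first by rewrite !big_ord0.
by rewrite !big_ord_recl IH.
Qed.

Lemma dotp_complex n (z : n.-tuple R[i]) (x : n.-tuple R) :
  dotp z (rvec x) =
  dotp [tuple complex.Re (tnth z k) | k < n] x +i* dotp [tuple complex.Im (tnth z k) | k < n] x.
Proof.
rewrite /dotp -sum_complex; apply: eq_bigr => k _.
by rewrite !tnth_mktuple; case: (tnth z k) => a b; simpc.
Qed.

Lemma dotp_cvec n (r u x : n.-tuple R) :
  dotp (cvec r u) (rvec x) = dotp r x +i* dotp u x.
Proof.
by rewrite dotp_complex; congr (_ +i* _); congr (dotp _ x);
  apply: eq_from_tnth => k; rewrite !tnth_mktuple.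
Qed.

Lemma dotpNl n (u x : n.-tuple R) : dotp [tuple - tnth u k | k < n] x = - dotp u x.
Proof.
by rewrite /dotp -sumrN; apply: eq_bigr => k _; rewrite tnth_mktuple mulNr.
Qed.

(** Since i<ir - u, x> = -<r, x> - i<u, x>, the transform of f at ir - u is that of the damped
    payoff at -u, whence the sign of the sine. *)
Lemma fourier_kernelE n (f : n.-tuple R -> R) (r u x : n.-tuple R) :
  fourier_kernel f [tuple - tnth u k +i* tnth r k | k < n] x =
  (expR (- dotp r x) * f x * cos (dotp u x)) +i* (- (expR (- dotp r x) * f x * sin (dotp u x))).
Proof.
rewrite /fourier_kernel dotp_complex.
have -> : [tuple complex.Re (tnth [tuple - tnth u k +i* tnth r k | k < n] k) | k < n] =
          [tuple - tnth u k | k < n].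
  by apply: eq_from_tnth => k; rewrite !tnth_mktuple.
have -> : [tuple complex.Im (tnth [tuple - tnth u k +i* tnth r k | k < n] k) | k < n] = r.
  by apply: eq_from_tnth => k; rewrite !tnth_mktuple.
rewrite dotpNl /imC; simpc; rewrite /expC cosN sinN; simpc.
by congr (_ +i* _); ring.
Qed.

Lemma normr_Re_le_normc (z : R[i]) : `|complex.Re z| <= Normc.normc z.
Proof.
by case: z => a b /=; rewrite -sqrtr_sqr ler_wsqrtr// lerDl sqr_ge0.
Qed.

Lemma normr_Im_le_normc (z : R[i]) : `|complex.Im z| <= Normc.normc z.
Proof.
by case: z => a b /=; rewrite -sqrtr_sqr ler_wsqrtr// lerDr sqr_ge0.
Qed.

Lemma normc_le_ReIm (z : R[i]) :
  Normc.normc z <= `|complex.Re z| + `|complex.Im z|.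
Proof.
case: z => a b /=.
rewrite -[leRHS]ger0_norm ?addr_ge0// -sqrtr_sqr ler_wsqrtr//.
rewrite sqrrD !real_normK ?num_real// -addrA lerD2l lerDr.
by rewrite mulrn_wge0// mulr_ge0.
Qed.

(** The modulus dominates |Re| and |Im| and is at most their sum. *)
Lemma cintegrableP dd (T : measurableType dd) (mu : {measure set T -> \bar R}) (f : T -> R[i]) :
  cintegrable mu f <->
  mu.-integrable setT (fun x => (complex.Re (f x))%:E) /\
  mu.-integrable setT (fun x => (complex.Im (f x))%:E).
Proof.
have mnorm : measurable_fun setT (fun x => complex.Re (f x)) ->
    measurable_fun setT (fun x => complex.Im (f x)) ->
    measurable_fun setT (fun x => (Normc.normc (f x))%:E).
  move=> mRe mIm; apply/measurable_EFinP.
  rewrite (_ : (fun x => _) = fun x => Num.sqrt (complex.Re (f x) ^+ 2 + complex.Im (f x) ^+ 2)).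
    apply: (@measurableT_comp _ _ _ _ _ _ (@Num.sqrt R)).
      by apply: continuous_measurable_fun; exact: sqrt_continuous.
    by apply: measurable_funD; exact: measurable_funX.
  by apply/funext => x; case: (f x).
split=> [[mRe mIm fin]|[iRe iIm]].
  have inorm : mu.-integrable setT (fun x => (Normc.normc (f x))%:E).
    apply/integrableP; split; first exact: mnorm.
    under eq_integral do rewrite abse_EFin ger0_norm ?(le_trans _ (normr_Re_le_normc _))//.
    exact: fin.
  split; apply: (le_integrable measurableT _ _ inorm).
  - exact/measurable_EFinP.
  - by move=> x _; rewrite !abse_EFin lee_fin (le_trans (normr_Re_le_normc _))// ler_norm.
  - exact/measurable_EFinP.
  - by move=> x _; rewrite !abse_EFin lee_fin (le_trans (normr_Im_le_normc _))// ler_norm.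
have mRe : measurable_fun setT (fun x => complex.Re (f x)) by apply/measurable_EFinP;
  case/integrableP : iRe.
have mIm : measurable_fun setT (fun x => complex.Im (f x)) by apply/measurable_EFinP;
  case/integrableP : iIm.
split => //.
have := integrableD measurableT (integrable_abse iRe) (integrable_abse iIm).
move=> /integrableP[mD]; apply: le_lt_trans; apply: ge0_le_integral => //.
- by move=> x _; rewrite lee_fin (le_trans _ (normr_Re_le_normc _)).
- exact: mnorm.
- exact: measurableT_comp.
- by move=> x _; rewrite /= lee_fin ger0_norm ?addr_ge0// normc_le_ReIm.
Qed.

End complex_values.

Section fubini_trig.
Context {R : realType} {d : nat}.
Local Notation lam := (leb R d).

(** The expression A Gc + B Gs is the real part of (A + iB)(Gc - i Gs). Taking A, B to be the real
    and imaginary parts of the twisted transform gives the real part of the pricing integrand;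
    replacing (A, B) by (B, -A) gives its imaginary part. Joint integrability follows from the bound
    (|A| + |B|) |g|. *)
Lemma fubini_trig (g A B : d.-tuple R -> R) :
  lam.-integrable setT (EFin \o g) -> lam.-integrable setT (EFin \o A) ->
  lam.-integrable setT (EFin \o B) ->
  let Gc u := fine (\int[lam]_y (g y * cos (dotp u y))%:E)%E in
  let Gs u := fine (\int[lam]_y (g y * sin (dotp u y))%:E)%E in
  lam.-integrable setT (fun u => (A u * Gc u + B u * Gs u)%:E) /\
  (\int[lam]_u (A u * Gc u + B u * Gs u)%:E =
   \int[lam]_y \int[lam]_u (g y * (A u * cos (dotp u y) + B u * sin (dotp u y)))%:E)%E.
Proof.
move=> ig iA iB Gc Gs.
have mg : measurable_fun setT g by apply/measurable_EFinP; case/integrableP : ig.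
have mA : measurable_fun setT A by apply/measurable_EFinP; case/integrableP : iA.
have mB : measurable_fun setT B by apply/measurable_EFinP; case/integrableP : iB.
pose h (z : d.-tuple R * d.-tuple R) :=
  g z.2 * (A z.1 * cos (dotp z.1 z.2) + B z.1 * sin (dotp z.1 z.2)).
have mdot : measurable_fun setT (fun z : d.-tuple R * d.-tuple R => dotp z.1 z.2).
  exact: measurable_dotp2.
have ih : (lam \x lam)%E.-integrable setT (EFin \o h).
  have iAB : lam.-integrable setT (EFin \o (fun u => `|A u| + `|B u|)).
    exact: integrableD (integrable_abse iA) (integrable_abse iB).
  have [i _] := integral_tensor iAB ig.
  apply: le_integrable i => //.
  - apply/measurable_EFinP/measurable_funM; first exact: measurableT_comp.
    apply: measurable_funD; apply: measurable_funM.
    + exact: measurableT_comp.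
    + exact: (measurableT_comp (@measurable_cos R)).
    + exact: measurableT_comp.
    + exact: (measurableT_comp (@measurable_sin R)).
  - move=> z _; rewrite !abse_EFin lee_fin !normrM mulrC ler_wpM2r//.
    rewrite [leRHS]ger0_norm ?addr_ge0// (le_trans (ler_normD _ _))// !normrM lerD// ler_piMr//.
    + exact: cos_max.
    + exact: sin_max.
have E u : (\int[lam]_y (h (u, y))%:E = (A u * Gc u + B u * Gs u)%:E)%E.
  have ic : lam.-integrable setT (fun y => (g y * cos (dotp u y))%:E).
    by apply: integrableM_bounded => // [|y]; [exact: measurable_cosd|exact: cos_max].
  have is_ : lam.-integrable setT (fun y => (g y * sin (dotp u y))%:E).
    by apply: integrableM_bounded => // [|y]; [exact: measurable_sind|exact: sin_max].
  have [_ <-] := integral_lincomb (A u) (B u) ic is_.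
  by apply: eq_integral => y _; rewrite /h/=; congr EFin; ring.
split.
  have := integrable_fubini_F ih; rewrite /fubini_F /=.
  by apply: eq_integrable => // u _ /=; rewrite E.
by rewrite -(Fubini ih); apply: eq_integral => u _; rewrite -E.
Qed.

End fubini_trig.

Theorem theorem3p2
  (R : realType) (d : nat) (d_ge1 : (1 <= d)%N)
  (* stochastic basis on [0, T], with F_T the whole sigma-algebra *)
  (disp : measure_display) (Omega : measurableType disp)
  (P : probability Omega R) (T : R) (T_ge0 : 0 <= T)
  (F : R -> set (set Omega)) (F_basis : stochastic_basis T F)
  (F_T : F T = measurable)
  (* semimartingale H and its canonical representation relative to h *)
  (H : R -> Omega -> d.-tuple R)
  (H_semimart : forall j : 'I_d, semimartingale P T F (fun t w => tnth (H t w) j))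
  (h : d.-tuple R -> d.-tuple R) (h_trunc : truncation_function h)
  (B Hc : 'I_d -> R -> Omega -> R)
  (nu : Omega -> {measure set (R * d.-tuple R) -> \bar R})
  (H_repr : canonical_representation P T F H h B Hc nu)
  (* asset prices; P is a martingale measure *)
  (S0 : 'I_d -> R) (S0_gt0 : forall j, 0 < S0 j)
  (Sp : 'I_d -> R -> Omega -> R)
  (S_init : forall j w, Sp j 0 w = S0 j)
  (S_exp : forall j t w, 0 <= t -> t <= T ->
     Sp j t w = S0 j * expR (tnth (H t w) j))
  (S_mart : forall j, local_martingale P T F (Sp j))
  (* underlying X_T, measurable for F_T = measurable *)
  (Psi : (R -> d.-tuple R) -> d.-tuple R)
  (Psi_meas : measurable_functional T Psi)
  (X : {RV P >-> d.-tuple R})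
  (X_Psi : forall w, X w = Psi (fun t => H t w))
  (* payoff and damping *)
  (f : d.-tuple R -> R) (f_meas : measurable_fun [set: d.-tuple R] f)
  (f_ge0 : forall x, 0 <= f x)
  (r : d.-tuple R)
  (g_L1 : (leb R d).-integrable [set: d.-tuple R]
            (fun x => (expR (- dotp r x) * f x)%:E))
  (M_r : ('E_P[fun w => expR (dotp r (X w))] < +oo)%E)
  (rho_L1 : cintegrable (leb R d)
              (fourier_measure (tilted r (distribution P X)))) :
  (* the complex vector i r - u *)
  let ir_minus (u : d.-tuple R) : d.-tuple R[i] :=
    [tuple - tnth u k +i* tnth r k | k < d] in
  let integrand (s u : d.-tuple R) : R[i] :=
    expC (- (imC R * (dotp u s)%:C)) * mgf P X (cvec r u)
      * fourier f (ir_minus u) in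
  (forall u : d.-tuple R,
     mgf_defined P X (cvec r u) /\
     fourier_defined f (ir_minus u)) /\
  (forall s : d.-tuple R,
     [/\ price P f X s \is a fin_num,
         cintegrable (leb R d) (integrand s) &
         (fine (price P f X s))%:C =
           (expR (- dotp r s) / (2 * pi) ^+ d)%:C
             * cintegral (leb R d) (integrand s)]).
Proof.
move=> ir_minus integrand.
pose g x := expR (- dotp r x) * f x.
have mer : measurable_fun [set: d.-tuple R] (fun x => expR (dotp r x)).
  by apply: measurableT_comp => //; exact: measurable_dotp.
have menr : measurable_fun [set: d.-tuple R] (fun x => expR (- dotp r x)).
  by apply: measurableT_comp => //; apply: measurableT_comp => //; exact: measurable_dotp.
have iP : P.-integrable setT (fun w => (expR (dotp r (X w)))%:E).
  apply/integrableP; split.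
    by apply/measurable_EFinP; exact: (measurableT_comp mer).
  under eq_integral do rewrite abse_EFin ger0_norm ?expR_ge0//.
  by move: M_r; rewrite unlock.
have finm : fin_num_fun (tilted r (distribution P X)).
  move=> A mA; rewrite ge0_fin_numE//.
  apply: (@le_lt_trans _ _ (tilted r (distribution P X) setT));
    first by apply: le_measure => //; rewrite inE.
  rewrite /tilted (ge0_integral_distribution X); first by move: M_r; rewrite unlock.
  - exact/measurable_EFinP.
  - by move=> x; rewrite lee_fin expR_ge0.
(* The total mass of the tilted law is the moment assumed finite, so it can be repackaged as a
   finite measure; only the equality of set functions is kept. *)
have [m mtilt] : exists m : {finite_measure set (d.-tuple R) -> \bar R},
    m = tilted r (distribution P X) :> (set (d.-tuple R) -> \bar R).
  pose m0 : {finite_measure set (d.-tuple R) -> \bar R} :=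
    HB.pack (tilted r (distribution P X)) (Measure_isFinite.Build _ _ _ (tilted r (distribution P X)) finm).
  by exists m0.
have mmu A : measurable A -> (m A = \int[distribution P X]_(x in A) (expR (dotp r x))%:E)%E.
  by move=> _; rewrite mtilt.
have er_ge0 x : 0 <= expR (dotp r x) by exact: expR_ge0.
have iPF (q : d.-tuple R -> R) : measurable_fun setT q -> (forall x, `|q x| <= 1) ->
    P.-integrable setT (fun w => (expR (dotp r (X w)) * q (X w))%:E).
  move=> mq q1; apply: (integrableM_bounded iP) => //.
  exact: measurableT_comp.
have mP (q : d.-tuple R -> R) : measurable_fun setT q -> (forall x, `|q x| <= 1) ->
    (\int[P]_w (expR (dotp r (X w)) * q (X w))%:E = \int[m]_x (q x)%:E)%E.
  move=> mq q1; rewrite (integral_density mer er_ge0 mmu mq).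
  rewrite (integral_distribution (X := X))/=.
  - by apply: eq_integral => w _; rewrite mulrC.
  - by apply/measurable_EFinP; exact: measurable_funM.
  - by apply: eq_integrable (iPF q mq q1) => // w _ /=; rewrite mulrC.
have mgfE u : mgf P X (cvec r u) = cos_transform m u +i* sin_transform m u.
  rewrite /mgf /cintegral; congr (fine _ +i* fine _).
  - rewrite -(mP _ (measurable_cosd u) (fun=> cos_max _)); apply: eq_integral => w _.
    by rewrite dotp_cvec.
  - rewrite -(mP _ (measurable_sind u) (fun=> sin_max _)); apply: eq_integral => w _.
    by rewrite dotp_cvec.
have rhoE u : fourier_measure (tilted r (distribution P X)) u = cos_transform m u +i* sin_transform m u.
  by rewrite -mtilt /fourier_measure /cintegral; congr (fine _ +i* fine _);
    apply: eq_integral => x _; rewrite expC_imM.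
have [jc js] : (leb R d).-integrable setT (EFin \o cos_transform m) /\
               (leb R d).-integrable setT (EFin \o sin_transform m).
  have [h1 h2] := (cintegrableP _ _).1 rho_L1; split.
  - by apply: eq_integrable h1 => // u _; rewrite rhoE.
  - by apply: eq_integrable h2 => // u _; rewrite rhoE.
pose Gc u := fine (\int[leb R d]_y (g y * cos (dotp u y))%:E)%E.
pose Gs u := fine (\int[leb R d]_y (g y * sin (dotp u y))%:E)%E.
have igc u : (leb R d).-integrable setT (fun y => (g y * cos (dotp u y))%:E).
  by apply: integrableM_bounded => // [|y]; [exact: measurable_cosd|exact: cos_max].
have igs u : (leb R d).-integrable setT (fun y => (g y * sin (dotp u y))%:E).
  by apply: integrableM_bounded => // [|y]; [exact: measurable_sind|exact: sin_max].
have fourierE u : fourier f (ir_minus u) = Gc u +i* (- Gs u).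
  rewrite /fourier /cintegral; congr (_ +i* _).
    by congr fine; apply: eq_integral => x _; rewrite fourier_kernelE.
  rewrite /Gs -fineN -integralN/=; last exact: integrable_add_def.
  by congr fine; apply: eq_integral => x _; rewrite fourier_kernelE.
(* The product of [re_twist] + i [im_twist] and [Gc] - i [Gs], the factor e^(-i<u, s>) having been
   absorbed into the twist at s. *)
have integrandE s u : integrand s u =
    (re_twist m s u * Gc u + im_twist m s u * Gs u) +i*
    (im_twist m s u * Gc u + - re_twist m s u * Gs u).
  rewrite /integrand mgfE fourierE /imC /re_twist /im_twist; simpc.
  rewrite cosN sinN expR0.
  by congr (_ +i* _); ring.
split=> [u|s].
  split; apply/cintegrableP; split.
  - apply: eq_integrable (iPF _ (measurable_cosd u) (fun=> cos_max _)) => // w _ /=.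
    by rewrite dotp_cvec.
  - apply: eq_integrable (iPF _ (measurable_sind u) (fun=> sin_max _)) => // w _ /=.
    by rewrite dotp_cvec.
  - by apply: eq_integrable (igc u) => // x _ /=; rewrite fourier_kernelE.
  - by apply: eq_integrable (integrableN (igs u)) => // x _ /=; rewrite fourier_kernelE.
have iA := integrable_re_twist jc js s.
have iB := integrable_im_twist jc js s.
have iNA : (leb R d).-integrable setT (EFin \o (fun u => - re_twist m s u)).
  exact: integrableN iA.
have [iRe IRe] := fubini_trig g_L1 iA iB.
have [iIm IIm] := fubini_trig g_L1 iB iNA.
(* The opposite of s, so that [subt y s'] is y + s. *)
pose s' : d.-tuple R := [tuple - tnth s k | k < d].
have dotps' u y : dotp u (subt y s') = dotp u y + dotp u s.
  by rewrite dotp_subt (dotpC u s') dotpNl opprK (dotpC s).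
(* The kernel e^(-i<u, y>) coming from the payoff multiplies the twist e^(-i<u, s>), so the inner
   integral over u is the inverse transform at y + s. *)
have ReE y : (\int[leb R d]_u (g y * (re_twist m s u * cos (dotp u y) + im_twist m s u * sin (dotp u y)))%:E =
    (g y * inv_fourier m (subt y s'))%:E)%E.
  rewrite EFinM -inv_fourierE// -integralZl//; last exact: integrable_re_twist.
  apply: eq_integral => u _; rewrite -EFinM /re_twist /im_twist dotps' cosD sinD.
  by congr EFin; ring.
have ImE y : (\int[leb R d]_u (g y * (im_twist m s u * cos (dotp u y) + - re_twist m s u * sin (dotp u y)))%:E =
    0)%E.
  rewrite -(mule0 (g y)%:E) -(integral_im_twist jc js (subt y s')) -integralZl//;
    last exact: integrable_im_twist.
  apply: eq_integral => u _; rewrite -EFinM /re_twist /im_twist dotps' cosD sinD.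
  by congr EFin; ring.
have g_ge0 y : 0 <= g y by rewrite mulr_ge0 ?expR_ge0.
have mg : measurable_fun setT g by exact: measurable_funM.
have priceE : (price P f X s = (expR (- dotp r s) / (2 * pi) ^+ d)%:E *
    \int[leb R d]_u (re_twist m s u * Gc u + im_twist m s u * Gs u)%:E)%E.
  rewrite /price unlock.
  have mfs : measurable_fun [set: d.-tuple R] (fun x => f (subt x s)).
    exact: (measurableT_comp f_meas (@measurable_subt _ _ s)).
  (* Insert e^(-<r, x>) e^(<r, x>) = 1: the second factor turns the law into the tilted measure, the
     first will damp the payoff. *)
  transitivity (\int[distribution P X]_x (f (subt x s) * expR (- dotp r x) * expR (dotp r x))%:E)%E.
    rewrite (ge0_integral_distribution X)/=.
    - by apply: eq_integral => w _; rewrite /= -mulrA -expRD addNr expR0 mulr1.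
    - by apply/measurable_EFinP/measurable_funM => //; exact: measurable_funM.
    - by move=> x; rewrite lee_fin !mulr_ge0 ?expR_ge0.
  rewrite -(ge0_integral_density (nu := m) mer er_ge0 mmu (F := (fun x => f (subt x s) * expR (- dotp r x)))); last 2 first.
  - exact: measurable_funM.
  - by move=> x; rewrite mulr_ge0 ?expR_ge0.
  rewrite (ge0_integral_density (measurable_inv_density jc js) (inv_density_ge0 jc js) (fourier_inversion jc js)); last 2 first.
  - exact: measurable_funM.
  - by move=> x; rewrite mulr_ge0 ?expR_ge0.
  pose K := expR (- dotp r s) / (2 * pi) ^+ d.
  have K0 : 0 <= K by rewrite divr_ge0 ?expR_ge0// exprn_ge0// mulr_ge0// pi_ge0.
  have mgi : measurable_fun setT (fun y => g y * inv_fourier m (subt y s')).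
    apply: measurable_funM => //.
    exact: (measurableT_comp (measurable_inv_fourier jc js) (@measurable_subt _ _ s')).
  (* Chosen so that the price integrand at x is G at x - s: the damping splits as e^(-<r, x>) =
     e^(-<r, s>) e^(-<r, x - s>), and translation invariance then removes s from the payoff. *)
  pose G y := (K * (g y * inv_fourier m (subt y s')))%:E.
  transitivity (\int[leb R d]_x G (subt x s))%E.
    apply: eq_integral => x _; rewrite /G /K /g /inv_density.
    have -> : subt (subt x s) s' = x.
      by apply: eq_from_tnth => k; rewrite !tnth_mktuple opprK subrK.
    rewrite dotp_subt opprB expRD.
    have e1 : expR (- dotp r s) * expR (dotp r s) = 1 by rewrite -expRD addNr expR0.
    congr EFin; transitivity (f (subt x s) * expR (- dotp r x) * (inv_fourier m x / (2 * pi) ^+ d) *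
      (expR (- dotp r s) * expR (dotp r s))); first by rewrite e1 mulr1.
    by ring.
  rewrite ge0_integral_leb_translation.
  - rewrite IRe; under [in RHS]eq_integral do rewrite ReE.
    rewrite -ge0_integralZl//.
    + exact/measurable_EFinP.
    + by move=> y _; rewrite lee_fin mulr_ge0// inv_fourier_ge0.
  - by apply/measurable_EFinP; exact: measurable_funM.
  - by move=> y; rewrite lee_fin (mulr_ge0 K0)// (mulr_ge0 (g_ge0 y))// inv_fourier_ge0.
split.
(* Finiteness of the price is inherited from the Fourier side through [priceE]. *)
- by rewrite priceE fin_numM// integrable_fin_num.
- apply/cintegrableP; split.
  + by apply: eq_integrable iRe => // u _; rewrite integrandE.
  + by apply: eq_integrable iIm => // u _; rewrite integrandE.
- have -> : cintegral (leb R d) (integrand s) =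
    (fine (\int[leb R d]_u (re_twist m s u * Gc u + im_twist m s u * Gs u)%:E))%:C.
    rewrite /cintegral; congr (fine _ +i* _).
      by apply: eq_integral => u _; rewrite integrandE.
    transitivity (fine (\int[leb R d]_u (im_twist m s u * Gc u + - re_twist m s u * Gs u)%:E)).
      by congr fine; apply: eq_integral => u _; rewrite integrandE.
    by rewrite IIm integral0_eq// => y _; rewrite ImE.
  by rewrite priceE fineM ?integrable_fin_num// rmorphM.
Qed.
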